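(* Let $\mathcal X$ be a minimal subshift of $A^{\mathbb Z}$, where $A$ is a finite alphabet. Then, for every $x\in\mathcal X$, the profinite group $G(\mathcal X)$ is isomorphic, as a profinite group, to the inverse limit $\varprojlim_n \hat\Pi_{2n}(\mathcal X,x)$.
   Context: Subshifts. $A$ is a finite set with the discrete topology, $A^{\mathbb Z}$ has the product topology, and $\sigma((x_i)_{i\in\mathbb Z})=(x_{i+1})_{i\in\mathbb Z}$ is the shift. A subshift of $A^{\mathbb Z}$ is a nonempty closed $\mathcal X\subseteq A^{\mathbb Z}$ with $\sigma(\mathcal X)=\mathcal X$; it is minimal if it contains no proper subshift. Write $x_{[i,j]}=x_ix_{i+1}\cdots x_j$. $L(\mathcal X)\subseteq A^+$ is the set of finite blocks $x_{[i,j]}$ ($i\le j$) of elements $x\in\mathcal X$, and $L_n(\mathcal X)$ is the set of words of length $n$ in $L(\mathcal X)$. $\mathcal X$ is irreducible if for all $u,v\in L(\mathcal X)$ there is $w\in A^+$ with $uwv\in L(\mathcal X)$; minimal subshifts are irreducible. The group $G(\mathcal X)$. Let $\overline{\Omega}_A\mathsf S$ be the free profinite semigroup generated by $A$; it contains the free semigroup $A^+$ as a dense subsemigroup. For $\mathcal X$ irreducible, let $\overline{L(\mathcal X)}$ be the closure of $L(\mathcal X)$ in $\overline{\Omega}_A\mathsf S$. It contains a unique regular $\mathcal J$-class $J(\mathcal X)$ such that every element of $\overline{L(\mathcal X)}$ is a factor of every element of $J(\mathcal X)$. The maximal subgroups of $J(\mathcal X)$ are isomorphic profinite groups, and $G(\mathcal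 X)$ (the Schützenberger group of $\mathcal X$) denotes the corresponding abstract profinite group. Rauzy graphs and fundamental groups. Graphs are directed. For $n\ge 1$ the Rauzy graph $\Sigma_{2n}(\mathcal X)$ has vertex set $L_{2n}(\mathcal X)$ and edge set $L_{2n+1}(\mathcal X)$, where the edge $a_1a_2\cdots a_{2n+1}$ ($a_i\in A$) goes from $a_1\cdots a_{2n}$ to $a_2\cdots a_{2n+1}$. For $m\ge n$ let $p_{m,n}\colon\Sigma_{2m}(\mathcal X)\to\Sigma_{2n}(\mathcal X)$ be the graph homomorphism sending $w\in L_{2m}(\mathcal X)\cup L_{2m+1}(\mathcal X)$, written $w=vuv'$ with $|v|=|v'|=m-n$, to $u$. The fundamental groupoid $\Pi(\Gamma)$ of a graph $\Gamma$ is obtained by adjoining a formal inverse edge $u^{-1}$ (with source and target exchanged) to each edge $u$ and taking the quotient of the free category on the resulting graph by the congruence generated by identifying each $uu^{-1}$ and $u^{-1}u$ with the corresponding empty paths; $\Pi$ is a functor from graphs to groupoids. Let $\Pi_{2n}(\mathcal X)=\Pi(\Sigma_{2n}(\mathcal X))$, and let $\hat\Pi_{2n}(\mathcal X)$ be its profinite completion, i.e. the inverse limit of its finite quotients $\Pi_{2n}(\mathcal X)/\theta$ by groupoid congruences $\theta$ (which identify only coterminal edges). $\hat\Pi_{2n}(\mathcal X,x)$ is the local group of $\hat\Pi_{2n}(\mathcal X)$ at the vertex $x_{[-n,n-1]}$ (it is the profinite completion of the fundamental group of $\Sigma_{2n}(\mathcal X)$ based at $x_{[-n,n-1]}$). The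 connecting morphisms $\hat\Pi_{2m}(\mathcal X,x)\to\hat\Pi_{2n}(\mathcal X,x)$ ($m\ge n$) of the inverse system are induced by $\Pi(p_{m,n})$. *)

(* Defs.v *)
From HB Require Import structures.
From mathcomp Require Import all_boot all_order all_algebra.
From mathcomp Require Import all_classical reals topology.

Set Implicit Arguments.
Unset Strict Implicit.
Unset Printing Implicit Defensive.

Local Open Scope classical_set_scope.
Local Open Scope quotient_scope.
Local Open Scope group_scope.

(* No axiom relates the product to the topology: the structure only lets one
   speak of multiplicative homeomorphisms. *)
#[short(type="spaceMagmaType")]
HB.structure Definition SpaceMagma := {T of Topological T & Magma T}.

(* [H], with the topology and the product induced by [S], is isomorphic to [G]
   algebraically and topologically; for [H] a subgroup of [S] and [G] a group,
   this is isomorphism of topological groups. *)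
Definition isomorphic_topological_group (S : spaceMagmaType) (H : set S)
    (G : spaceMagmaType) :=
  exists (f : S -> G) (g : G -> S),
    [/\ {in H, cancel f g}, (forall y, H (g y)) /\ cancel g f,
        {in H &, {morph f : x y / x * y}},
        {within H, continuous f} & continuous g].

Arguments isomorphic_topological_group {S} H G.

Definition to_set_type T (A : set T) (x : T) (Ax : x \in A) : set_type A :=
  exist _ x Ax.

Section Words.
Variable A : choiceType.

Record word := Word { letters :> seq A; _ : letters != [::] }.

HB.instance Definition _ := [isSub for letters].
HB.instance Definition _ := [Choice of word by <:].

Lemma word_cat_subproof (u v : word) : letters u ++ letters v != [::].
Proof. by case: u => -[]. Qed.

Definition word_cat (u v : word) := Word (word_cat_subproof u v).

Lemma word_catA : associative word_cat.
Proof. by move=> u v w; apply/val_inj/catA. Qed.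

HB.instance Definition _ := isSemigroup.Build word word_catA.

End Words.

Definition full_shift (A : finType) := {ptws int -> discrete_topology A}.

Definition shift (A : finType) (x : full_shift A) : full_shift A :=
  fun i => x (i + 1)%R.

Definition subshift (A : finType) (X : set (full_shift A)) :=
  [/\ X !=set0, closed X & @shift A @` X = X].

Definition minimal_subshift (A : finType) (X : set (full_shift A)) :=
  subshift X /\ (forall Y, subshift Y -> Y `<=` X -> Y = X).

(* x_[i, i + n - 1] *)
Definition block (A : finType) (x : full_shift A) (i : int) (n : nat) :
  n.-tuple A := [tuple x (i + k%:Z)%R | k < n].

(* L(X), inside A^+ *)
Definition language (A : finType) (X : set (full_shift A)) : set (word A) :=
  [set w | exists x i, X x /\ letters w = block x i (size w)].

(* L_n(X); for n = 0 this is the empty word, which [language] excludes *)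
Definition language_of_length (A : finType) (X : set (full_shift A)) (n : nat) :
  set (n.-tuple A) := [set w | exists x i, X x /\ w = block x i n].

Arguments language_of_length {A} X n _.

(* The profinite completion of a semigroup is the inverse limit of its finite
   quotients, as a subspace of their product, each of them being discrete. *)

Section SemigroupCompletion.
Variable S : semigroupType.

Record finite_congruence := FiniteCongruence {
  cong :> equiv_rel S;
  congM : forall x x' y y', cong x x' -> cong y y' -> cong (x * y) (x' * y');
  cong_finite : finite_set [set: {eq_quot cong}] }.

Implicit Type t : finite_congruence.

Definition quot t := {eq_quot t}.

HB.instance Definition _ t := Choice.on (quot t).
HB.instance Definition _ t := EqQuotient.on (quot t).

Definition quot_mul t (a b : quot t) : quot t := \pi_(quot t) (repr a * repr b).

Lemma quot_piE t (x y : S) : (\pi_(quot t) x = \pi_(quot t) y) <-> t x y.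
Proof. by split=> [/eqquotP //|?]; apply/eqquotP. Qed.

Lemma quot_repr t x : t (repr (\pi_(quot t) x)) x.
Proof. by apply/quot_piE; rewrite reprK. Qed.

Lemma quot_mulE t x y :
  \pi_(quot t) (repr (\pi_(quot t) x) * repr (\pi_(quot t) y)) =
  \pi_(quot t) (x * y).
Proof. by apply/quot_piE/congM; apply: quot_repr. Qed.

Lemma quot_mulA t : associative (@quot_mul t).
Proof.
move=> a b c; rewrite -[a]reprK -[b]reprK -[c]reprK.
by rewrite /quot_mul !quot_mulE !reprK mulgA.
Qed.

HB.instance Definition _ t := isSemigroup.Build (quot t) (@quot_mulA t).

Definition coherent :
    set (prod_topology (fun t => discrete_topology (quot t))) :=
  [set c | forall t t', (forall x y, t x y -> t' x y) ->
           \pi_(quot t') (repr (c t)) = c t'].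

Definition semigroup_completion : Type := set_type coherent.

HB.instance Definition _ := Topological.copy semigroup_completion
  (set_type coherent).

Lemma completion_mul_subproof (c d : semigroup_completion) :
  (fun t => (val c t : quot t) * (val d t : quot t)) \in coherent.
Proof.
case: c d => c /= /set_mem cc [d /= /set_mem cd]; apply/mem_set => t t' le.
rewrite -(cc _ _ le) -(cd _ _ le) [RHS]quot_mulE; apply/quot_piE.
by apply: le; apply: quot_repr.
Qed.

Definition completion_mul (c d : semigroup_completion) : semigroup_completion :=
  to_set_type (completion_mul_subproof c d).

Lemma completion_mulA : associative completion_mul.
Proof.
move=> a b c; apply/val_inj/functional_extensionality_dep => t /=.
exact: quot_mulA.
Qed.

HB.instance Definition _ :=
  isSemigroup.Build semigroup_completion completion_mulA.

Lemma completion_eta_subproof (x : S) :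
  (fun t => \pi_(quot t) x : discrete_topology (quot t)) \in coherent.
Proof. by apply/mem_set => t t' le; apply/quot_piE/le/quot_repr. Qed.

Definition completion_eta (x : S) : semigroup_completion :=
  to_set_type (completion_eta_subproof x).

End SemigroupCompletion.

Arguments completion_eta {S} x.

(* The A-generated finite semigroups are the finite quotients of A^+, so the
   free profinite semigroup on A is the profinite completion of A^+. *)
Definition free_profinite_semigroup (A : finType) : Type :=
  semigroup_completion (word A).

HB.instance Definition _ (A : finType) :=
  Topological.copy (free_profinite_semigroup A) (semigroup_completion (word A)).
HB.instance Definition _ (A : finType) :=
  Semigroup.copy (free_profinite_semigroup A) (semigroup_completion (word A)).

Section Green.
Variable S : semigroupType.
Implicit Types (u v : S) (H J : set S).

(* u = p v q with p and q in S^1, [None] standing for the adjoined identity *)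
Definition factor_of v u :=
  exists p q : option S,
    let vq := if q is Some b then v * b else v in
    u = if p is Some a then a * vq else vq.

Definition J_class J :=
  exists u, J = [set v | factor_of u v /\ factor_of v u].

Definition regular_J_class J :=
  J_class J /\ (forall u, J u -> exists v, u * v * u = u).

Definition is_subgroup H :=
  (forall x y, H x -> H y -> H (x * y)) /\
  (exists e, [/\ H e, forall x, H x -> e * x = x /\ x * e = x &
    forall x, H x -> exists y, [/\ H y, x * y = e & y * x = e]]).

Definition maximal_subgroup H :=
  is_subgroup H /\ (forall K, is_subgroup K -> H `<=` K -> K = H).

End Green.

Section SchutzenbergerGroup.
Variables (A : finType) (X : set (full_shift A)).

Definition language_closure : set (free_profinite_semigroup A) :=
  closure ((completion_eta : word A -> free_profinite_semigroup A)
             @` language X).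

(* J is J(X) *)
Definition is_JX (J : set (free_profinite_semigroup A)) :=
  [/\ regular_J_class J, J `<=` language_closure &
      forall u v, language_closure v -> J u -> factor_of v u].

(* H is one of the (mutually isomorphic) incarnations of G(X) *)
Definition schutzenberger_group (H : set (free_profinite_semigroup A)) :=
  maximal_subgroup H /\ (exists2 J, is_JX J & H `<=` J).

End SchutzenbergerGroup.

(* Composition is in diagrammatic order. The objects form a finite type, so a
   quotient by a congruence is finite as soon as its hom sets are. *)

Record groupoid := Groupoid {
  ob : finType;
  hom : ob -> ob -> choiceType;
  gid : forall u, hom u u;
  gcomp : forall u v w, hom u v -> hom v w -> hom u w;
  ginv : forall u v, hom u v -> hom v u;
  gcompA : forall u v w z (f : hom u v) (g : hom v w) (h : hom w z),
    gcomp f (gcomp g h) = gcomp (gcomp f g) h;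
  gcomp1l : forall u v (f : hom u v), gcomp (gid u) f = f;
  gcomp1r : forall u v (f : hom u v), gcomp f (gid v) = f;
  gcompVl : forall u v (f : hom u v), gcomp (ginv f) f = gid v;
  gcompVr : forall u v (f : hom u v), gcomp f (ginv f) = gid u }.

Arguments hom {G} u v : rename.
Arguments gid {G} u : rename.

Record groupoid_functor (G G' : groupoid) := GroupoidFunctor {
  fob :> ob G -> ob G';
  fhom : forall u v, hom u v -> hom (fob u) (fob v);
  fhom1 : forall u, fhom (gid u) = gid (fob u);
  fhomM : forall u v w (f : hom u v) (g : hom v w),
    fhom (gcomp f g) = gcomp (fhom f) (fhom g) }.

Definition local_group (G : groupoid) (v : ob G) : Type := hom v v.

HB.instance Definition _ G v := Choice.on (@local_group G v).
HB.instance Definition _ G v := isGroup.Build (@local_group G v)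
  (@gcompA G v v v v) (@gcomp1l G v v) (@gcomp1r G v v)
  (@gcompVl G v v) (@gcompVr G v v).

Section GroupoidCompletion.
Variable G : groupoid.

Record finite_gcongruence := FiniteGCongruence {
  gcong :> forall u v, equiv_rel (@hom G u v);
  gcongM : forall u v w (f f' : hom u v) (g g' : hom v w),
    gcong u v f f' -> gcong v w g g' -> gcong u w (gcomp f g) (gcomp f' g');
  gcong_finite : forall u v, finite_set [set: {eq_quot (gcong u v)}] }.

Implicit Type t : finite_gcongruence.

Lemma gcongV t u v (f f' : hom u v) : t u v f f' -> t v u (ginv f) (ginv f').
Proof.
move=> ff'; rewrite equiv_sym.
rewrite -[ginv f']gcomp1r -(gcompVr f) -[X in t v u _ X]gcomp1l -(gcompVl f').
rewrite gcompA; apply: gcongM => //; apply: gcongM => //.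
Qed.

Definition ghom t u v := {eq_quot (t u v)}.

HB.instance Definition _ t u v := Choice.on (ghom t u v).
HB.instance Definition _ t u v := EqQuotient.on (ghom t u v).

Definition gpi t u v (f : hom u v) : ghom t u v := \pi_(ghom t u v) f.

Lemma gpiE t u v (f g : hom u v) : gpi t f = gpi t g <-> t u v f g.
Proof. by split=> [/eqquotP //|?]; apply/eqquotP. Qed.

Lemma gpiK t u v (a : ghom t u v) : gpi t (repr a) = a.
Proof. exact: reprK. Qed.

Lemma grepr t u v (f : hom u v) : t u v (repr (gpi t f)) f.
Proof. by apply/gpiE; rewrite gpiK. Qed.

Lemma gquot_compE t u v w (f : hom u v) (g : hom v w) :
  gpi t (gcomp (repr (gpi t f)) (repr (gpi t g))) = gpi t (gcomp f g).
Proof. by apply/gpiE/gcongM; apply: grepr. Qed.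

Lemma gquot_invE t u v (f : hom u v) :
  gpi t (ginv (repr (gpi t f))) = gpi t (ginv f).
Proof. by apply/gpiE/gcongV/grepr. Qed.

Definition gquot t : groupoid.
Proof.
refine (@Groupoid (ob G) (fun u v => ghom t u v) (fun u => gpi t (gid u))
  (fun u v w a b => gpi t (gcomp (repr a) (repr b)))
  (fun u v a => gpi t (ginv (repr a))) _ _ _ _ _).
- move=> u v w z f g h; rewrite -[f]gpiK -[g]gpiK -[h]gpiK.
  by rewrite !gquot_compE !gpiK gcompA.
- by move=> u v f; rewrite -[f]gpiK gquot_compE gcomp1l.
- by move=> u v f; rewrite -[f]gpiK gquot_compE gcomp1r.
- by move=> u v f; rewrite -[f]gpiK gquot_invE gquot_compE gcompVl.
- by move=> u v f; rewrite -[f]gpiK gquot_invE gquot_compE gcompVr.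
Defined.

Definition gcoherent u v :
    set (prod_topology (fun t => discrete_topology (@hom (gquot t) u v))) :=
  [set c | forall t t', (forall u v f g, t u v f g -> t' u v f g) ->
           gpi t' (repr (c t : ghom t u v)) = c t'].

Arguments gcoherent u v : clear implicits.

Definition pro_hom u v : Type := set_type (gcoherent u v).

HB.instance Definition _ u v :=
  Topological.copy (pro_hom u v) (set_type (gcoherent u v)).

Lemma pro_id_subproof u :
  (fun t => @gid (gquot t) u : discrete_topology (@hom (gquot t) u u)) \in gcoherent u u.
Proof. by apply/mem_set => t t' le; apply/gpiE/le/grepr. Qed.

Definition pro_id u : pro_hom u u := to_set_type (pro_id_subproof u).

Lemma pro_comp_subproof u v w (c : pro_hom u v) (d : pro_hom v w) :
  (fun t => @gcomp (gquot t) u v w (val c t) (val d t)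
            : discrete_topology (@hom (gquot t) u w)) \in gcoherent u w.
Proof.
case: c d => c /= /set_mem cc [d /= /set_mem cd]; apply/mem_set => t t' le.
rewrite -(cc _ _ le) -(cd _ _ le) gquot_compE; apply/gpiE.
by apply: le; apply: grepr.
Qed.

Definition pro_comp u v w (c : pro_hom u v) (d : pro_hom v w) : pro_hom u w :=
  to_set_type (pro_comp_subproof c d).

Lemma pro_inv_subproof u v (c : pro_hom u v) :
  (fun t => @ginv (gquot t) u v (val c t) : discrete_topology (@hom (gquot t) v u))
    \in gcoherent v u.
Proof.
case: c => c /= /set_mem cc; apply/mem_set => t t' le.
rewrite -(cc _ _ le) gquot_invE; apply/gpiE.
by apply: le; apply: grepr.
Qed.

Definition pro_inv u v (c : pro_hom u v) : pro_hom v u :=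
  to_set_type (pro_inv_subproof c).

Lemma pro_homP u v (c d : pro_hom u v) : (forall t, val c t = val d t) -> c = d.
Proof. by move=> e; apply/val_inj/functional_extensionality_dep. Qed.

Definition completion : groupoid.
Proof.
refine (@Groupoid (ob G) (fun u v => pro_hom u v) pro_id pro_comp pro_inv
  _ _ _ _ _).
- by move=> u v w z f g h; apply: pro_homP => t; apply: (@gcompA (gquot t)).
- by move=> u v f; apply: pro_homP => t; apply: (@gcomp1l (gquot t)).
- by move=> u v f; apply: pro_homP => t; apply: (@gcomp1r (gquot t)).
- by move=> u v f; apply: pro_homP => t; apply: (@gcompVl (gquot t)).
- by move=> u v f; apply: pro_homP => t; apply: (@gcompVr (gquot t)).
Defined.

(* the local group of the completion, with its topology *)
Definition pro_local v : Type := @local_group completion v.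

HB.instance Definition _ v := Topological.copy (pro_local v) (pro_hom v v).
HB.instance Definition _ v :=
  Group.copy (pro_local v) (@local_group completion v).

End GroupoidCompletion.

Section CompletionFunctor.
Variables (G G' : groupoid) (F : groupoid_functor G G').

Section Pullback.
Variable t : finite_gcongruence G'.

Definition pullback_rel u v : rel (@hom G u v) :=
  fun f g => t _ _ (fhom F f) (fhom F g).

Lemma pullback_refl u v : reflexive (@pullback_rel u v).
Proof. by move=> f; apply: equiv_refl. Qed.

Lemma pullback_sym u v : symmetric (@pullback_rel u v).
Proof. by move=> f g; apply: equiv_sym. Qed.

Lemma pullback_trans u v : transitive (@pullback_rel u v).
Proof. by move=> f g h; apply: equiv_trans. Qed.

Definition pullback_equiv u v : equiv_rel (@hom G u v) :=
  EquivRel (@pullback_rel u v) (@pullback_refl u v) (@pullback_sym u v)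
    (@pullback_trans u v).

Lemma pullback_compM u v w (f f' : hom u v) (g g' : hom v w) :
  pullback_equiv u v f f' -> pullback_equiv v w g g' ->
  pullback_equiv u w (gcomp f g) (gcomp f' g').
Proof. by move=> ff' gg'; rewrite /= /pullback_rel !fhomM; apply: gcongM. Qed.

Lemma pullback_finite u v : finite_set [set: {eq_quot (pullback_equiv u v)}].
Proof.
pose h (a : {eq_quot (pullback_equiv u v)}) := gpi t (fhom F (repr a)).
have h_inj : {in [set: {eq_quot (pullback_equiv u v)}] &, injective h}.
  move=> a b _ _ /gpiE ab; rewrite -[a]reprK -[b]reprK.
  by apply/eqquotP.
rewrite -(eq_finite_set (inj_card_eq h_inj)).
exact: sub_finite_set (@subsetT _ _) (gcong_finite t _ _).
Qed.

Definition pullback : finite_gcongruence G :=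
  FiniteGCongruence pullback_compM pullback_finite.

End Pullback.

Lemma pro_map_subproof u v (c : pro_hom u v) :
  (fun t => gpi t (fhom F (repr (val c (pullback t) : ghom (pullback t) u v)))
            : discrete_topology (@hom (gquot t) (F u) (F v)))
    \in @gcoherent G' (F u) (F v).
Proof.
case: c => c /= /set_mem cc; apply/mem_set => t t' le.
have le' : forall u v f g, pullback t u v f g -> pullback t' u v f g.
  by move=> ? ? f g; apply: le.
rewrite -(cc _ _ le'); apply/gpiE.
apply: (equiv_trans (y := fhom F (repr (c (pullback t) : ghom _ u v)))).
  by apply: le; apply: grepr.
rewrite equiv_sym; exact: (grepr (pullback t')).
Qed.

(* the continuous functor induced by F between the completions *)
Definition pro_map u v (c : pro_hom u v) : pro_hom (F u) (F v) :=
  to_set_type (pro_map_subproof c).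

Lemma pro_mapM u v w (c : pro_hom u v) (d : pro_hom v w) :
  pro_map (pro_comp c d) = pro_comp (pro_map c) (pro_map d).
Proof.
apply: pro_homP => t /=; rewrite gquot_compE -fhomM; apply/gpiE.
exact: (grepr (pullback t)).
Qed.

Lemma pro_map1 u : pro_map (pro_id u) = pro_id (F u).
Proof.
apply: pro_homP => t /=; rewrite -fhom1; apply/gpiE.
exact: (grepr (pullback t)).
Qed.

(* the vertex F v is only propositionally equal to w in the application *)
Definition pro_local_map v w (e : F v = w) (c : pro_local v) : pro_local w :=
  ecast w (pro_local w) e (pro_map c : pro_local (F v)).

Lemma pro_local_mapM v w (e : F v = w) : {morph pro_local_map e : x y / x * y}.
Proof. by case: w / e => x y; apply: pro_mapM. Qed.

Lemma pro_local_map1 v w (e : F v = w) : pro_local_map e 1 = 1.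
Proof. by case: w / e; apply: pro_map1. Qed.

Lemma pro_local_mapV v w (e : F v = w) : {morph pro_local_map e : x / x^-1}.
Proof.
move=> x; rewrite -[RHS]mulg1 -(pro_local_map1 e) -(mulgV x) pro_local_mapM.
by rewrite mulKg.
Qed.

End CompletionFunctor.

Record digraph := Digraph {
  vertex : finType;
  edge : finType;
  source : edge -> vertex;
  target : edge -> vertex }.

Record digraph_morphism (D D' : digraph) := DigraphMorphism {
  vmap : vertex D -> vertex D';
  emap : edge D -> edge D';
  source_emap : forall e, source (emap e) = vmap (source e);
  target_emap : forall e, target (emap e) = vmap (target e) }.

Section FundamentalGroupoid.
Variable D : digraph.

(* [(e, false)] is the edge e and [(e, true)] its formal inverse *)
Definition sedge := (edge D * bool)%type.

Definition ssource (a : sedge) := if a.2 then target a.1 else source a.1.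
Definition starget (a : sedge) := if a.2 then source a.1 else target a.1.
Definition sinv (a : sedge) : sedge := (a.1, ~~ a.2).

Fixpoint is_walk (u : vertex D) (s : seq sedge) (v : vertex D) : bool :=
  if s is a :: s' then (u == ssource a) && is_walk (starget a) s' v else u == v.

(* the morphisms from u to v of the free category *)
Record walk (u v : vertex D) := Walk {
  steps :> seq sedge;
  _ : is_walk u steps v }.

HB.instance Definition _ u v := [isSub for @steps u v].
HB.instance Definition _ u v := [Choice of walk u v by <:].

Lemma is_walk_cat u v w s1 s2 :
  is_walk u s1 v -> is_walk v s2 w -> is_walk u (s1 ++ s2) w.
Proof.
elim: s1 u => [u /eqP -> //|a s1 IH u /= /andP[-> s1v] s2w].
exact: IH s1v s2w.
Qed.

Lemma is_walk_rev u v s : is_walk u s v -> is_walk v (rev (map sinv s)) u.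
Proof.
elim: s u => [u|a s IH u] /=; first by rewrite eq_sym.
move=> /andP[/eqP -> /IH sv]; rewrite rev_cons -cats1.
apply: is_walk_cat sv _; rewrite /= /ssource /starget /sinv /=.
by case: a.2; rewrite /= !eqxx.
Qed.

Definition walk_nil u : walk u u := Walk (eqxx u : is_walk u [::] u).

Definition walk_cat u v w (p : walk u v) (q : walk v w) : walk u w :=
  Walk (is_walk_cat (valP p) (valP q)).

Definition walk_rev u v (p : walk u v) : walk v u :=
  Walk (is_walk_rev (valP p)).

(* the congruence of the free category generated by the identifications of
   a a^-1 with an empty path, a an edge or a formal inverse *)
Inductive walk_eq : forall u v, walk u v -> walk u v -> Prop :=
| walk_eq_cancel a u v (p : walk u v) (q : walk v u) :
    steps p = [:: a] -> steps q = [:: sinv a] ->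
    walk_eq (walk_cat p q) (walk_nil u)
| walk_eq_refl u v (p : walk u v) : walk_eq p p
| walk_eq_sym u v (p q : walk u v) : walk_eq p q -> walk_eq q p
| walk_eq_trans u v (p q r : walk u v) :
    walk_eq p q -> walk_eq q r -> walk_eq p r
| walk_eq_cat u v w (p p' : walk u v) (q q' : walk v w) :
    walk_eq p p' -> walk_eq q q' -> walk_eq (walk_cat p q) (walk_cat p' q').

Section WalkEquiv.
Variables u v : vertex D.

Definition walk_eqb : rel (walk u v) := fun p q => `[< walk_eq p q >].

Lemma walk_eqb_refl : reflexive walk_eqb.
Proof. by move=> p; apply/asboolP/walk_eq_refl. Qed.

Lemma walk_eqb_sym : symmetric walk_eqb.
Proof. by move=> p q; apply/asboolP/asboolP; apply: walk_eq_sym. Qed.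

Lemma walk_eqb_trans : transitive walk_eqb.
Proof.
move=> q p r /asboolP pq /asboolP qr; apply/asboolP.
exact: walk_eq_trans pq qr.
Qed.

Definition walk_equiv : equiv_rel (walk u v) :=
  EquivRel walk_eqb walk_eqb_refl walk_eqb_sym walk_eqb_trans.

Definition fund_hom := {eq_quot walk_equiv}.

HB.instance Definition _ := Choice.on fund_hom.
HB.instance Definition _ := EqQuotient.on fund_hom.

Definition fpi (p : walk u v) : fund_hom := \pi_fund_hom p.

Lemma fpiE p q : fpi p = fpi q <-> walk_eq p q.
Proof.
by split=> [/eqquotP /asboolP //|pq]; apply/eqquotP/asboolP.
Qed.

Lemma fpiK (a : fund_hom) : fpi (repr a) = a.
Proof. exact: reprK. Qed.

Lemma frepr p : walk_eq (repr (fpi p)) p.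
Proof. by apply/fpiE; rewrite fpiK. Qed.

End WalkEquiv.

Lemma fund_compE u v w (p : walk u v) (q : walk v w) :
  fpi (walk_cat (repr (fpi p)) (repr (fpi q))) = fpi (walk_cat p q).
Proof. by apply/fpiE/walk_eq_cat; apply: frepr. Qed.

Lemma walk_eq_steps u v (p q : walk u v) : steps p = steps q -> walk_eq p q.
Proof. by move=> e; rewrite (val_inj e : p = q); apply: walk_eq_refl. Qed.

Lemma walk_cat_rev u v (p : walk u v) :
  walk_eq (walk_cat p (walk_rev p)) (walk_nil u).
Proof.
case: p => s; elim: s u => [|a s IH] u sw.
  have e : u = v by apply/eqP.
  by case: v / e sw => sw; apply: walk_eq_steps.
have /andP[/eqP ua sv] := sw.
have aw : is_walk u [:: a] (starget a) by rewrite /= ua !eqxx.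
have aw' : is_walk (starget a) [:: sinv a] u by apply: (is_walk_rev aw).
apply: walk_eq_trans (walk_eq_cancel (a := a) (p := Walk aw) (q := Walk aw') _ _);
  rewrite //.
pose m := walk_cat (Walk sv) (walk_rev (Walk sv)).
apply: (@walk_eq_trans _ _ _ (walk_cat (walk_cat (Walk aw) m) (Walk aw'))).
  by apply: walk_eq_steps; rewrite /= rev_cons -cats1 catA.
apply: walk_eq_cat; last exact: walk_eq_refl.
apply: (@walk_eq_trans _ _ _ (walk_cat (Walk aw) (walk_nil _))).
  by apply: walk_eq_cat; [apply: walk_eq_refl|apply: IH].
exact: walk_eq_steps.
Qed.

Lemma walk_revK u v (p : walk u v) : walk_rev (walk_rev p) = p.
Proof.
apply: val_inj; rewrite /= map_rev revK -map_comp map_id_in // => -[e b] _.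
by rewrite /= /sinv /= negbK.
Qed.

Lemma walk_rev_cat u v (p : walk u v) :
  walk_eq (walk_cat (walk_rev p) p) (walk_nil v).
Proof. by have := walk_cat_rev (walk_rev p); rewrite walk_revK. Qed.

Lemma walk_eq_rev u v (p q : walk u v) :
  walk_eq p q -> walk_eq (walk_rev p) (walk_rev q).
Proof.
move=> pq; pose r := walk_cat (walk_cat (walk_rev p) q) (walk_rev q).
apply: (@walk_eq_trans _ _ _ r).
  apply: (@walk_eq_trans _ _ _
    (walk_cat (walk_rev p) (walk_cat q (walk_rev q)))); last first.
    by apply: walk_eq_steps; rewrite /= catA.
  apply: (@walk_eq_trans _ _ _ (walk_cat (walk_rev p) (walk_nil _))).
    by apply: walk_eq_steps; rewrite /= cats0.
  by apply: walk_eq_cat; [apply: walk_eq_refl|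
    apply/walk_eq_sym/walk_cat_rev].
apply: (@walk_eq_trans _ _ _ (walk_cat (walk_nil _) (walk_rev q))).
  apply: walk_eq_cat; last exact: walk_eq_refl.
  apply: walk_eq_trans (walk_rev_cat p).
  by apply: walk_eq_cat; [apply: walk_eq_refl|apply: walk_eq_sym].
exact: walk_eq_steps.
Qed.

Lemma fund_invE u v (p : walk u v) :
  fpi (walk_rev (repr (fpi p))) = fpi (walk_rev p).
Proof. by apply/fpiE/walk_eq_rev/frepr. Qed.

(* Pi(D) *)
Definition fundamental_groupoid : groupoid.
Proof.
refine (@Groupoid (vertex D) (fun u v => fund_hom u v)
  (fun u => fpi (walk_nil u))
  (fun u v w a b => fpi (walk_cat (repr a) (repr b)))
  (fun u v a => fpi (walk_rev (repr a))) _ _ _ _ _).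
- move=> u v w z f g h; rewrite -[f]fpiK -[g]fpiK -[h]fpiK.
  rewrite !fund_compE !fpiK.
  by apply/fpiE/walk_eq_steps; rewrite /= catA.
- move=> u v f; rewrite -[f]fpiK fund_compE.
  exact/fpiE/walk_eq_steps.
- move=> u v f; rewrite -[f]fpiK fund_compE.
  by apply/fpiE/walk_eq_steps; rewrite /= cats0.
- move=> u v f; rewrite -[f]fpiK fund_invE fund_compE.
  exact/fpiE/walk_rev_cat.
- move=> u v f; rewrite -[f]fpiK fund_invE fund_compE.
  exact/fpiE/walk_cat_rev.
Defined.

End FundamentalGroupoid.

Section FundamentalFunctor.
Variables (D D' : digraph) (F : digraph_morphism D D').

Definition smap (a : sedge D) : sedge D' := (emap F a.1, a.2).

Lemma is_walk_map u v s :
  is_walk u s v -> is_walk (vmap F u) (map smap s) (vmap F v).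
Proof.
elim: s u => [u /eqP -> //=|[e b] s IH u /= /andP[/eqP -> /IH]].
by rewrite /ssource /starget /= source_emap target_emap; case: b; rewrite eqxx.
Qed.

Definition walk_map u v (p : walk u v) : walk (vmap F u) (vmap F v) :=
  Walk (is_walk_map (valP p)).

Lemma walk_map_eq u v (p q : walk u v) :
  walk_eq p q -> walk_eq (walk_map p) (walk_map q).
Proof.
elim=> {u v p q} [a u v p q pa qa|u v p|u v p q _|u v p q r _ pq _ qr|
    u v w p p' q q' _ pp' _ qq'].
- apply: walk_eq_trans (walk_eq_trans _ (walk_eq_cancel (a := smap a)
    (p := walk_map p) (q := walk_map q) _ _)) (walk_eq_steps _) => //=.
  + by apply: walk_eq_steps; rewrite /= map_cat.
  + by rewrite pa.
  + by rewrite qa.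
- exact: walk_eq_refl.
- exact: walk_eq_sym.
- exact: walk_eq_trans pq qr.
- apply: walk_eq_trans (walk_eq_trans _ (walk_eq_cat pp' qq'))
    (walk_eq_steps _); last by rewrite /= map_cat.
  by apply: walk_eq_steps; rewrite /= map_cat.
Qed.

(* Pi(F) *)
Definition fundamental_functor :
  groupoid_functor (fundamental_groupoid D) (fundamental_groupoid D').
Proof.
refine (@GroupoidFunctor (fundamental_groupoid D) (fundamental_groupoid D')
  (vmap F) (fun u v a => fpi (walk_map (repr a))) _ _).
- move=> u; apply/fpiE.
  apply: (@walk_eq_trans _ _ _ _ (walk_map (walk_nil u))).
    exact/walk_map_eq/frepr.
  exact: walk_eq_steps.
- move=> u v w f g /=; rewrite fund_compE; apply/fpiE.
  apply: (@walk_eq_trans _ _ _ _ (walk_map (walk_cat (repr f) (repr g)))).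
    exact/walk_map_eq/frepr.
  by apply: walk_eq_steps; rewrite /= map_cat.
Defined.

End FundamentalFunctor.

Section Subword.
Variables (A : finType) (n k l : nat) (kln : (k + l <= n)%N).

Lemma subword_subproof (j : 'I_l) : (k + j < n)%N.
Proof. by apply: leq_trans kln; rewrite ltn_add2l. Qed.

(* the block of length l of w starting at position k *)
Definition subword (w : n.-tuple A) : l.-tuple A :=
  [tuple tnth w (Ordinal (subword_subproof j)) | j < l].

End Subword.

Lemma subword_block (A : finType) n k l (kln : (k + l <= n)%N)
    (x : full_shift A) i :
  subword kln (block x i n) = block x (i + k%:Z)%R l.
Proof.
by apply: eq_from_tnth => j; rewrite !tnth_mktuple /= PoszD GRing.addrA.
Qed.

Lemma subword_subword (A : finType) n k l (kln : (k + l <= n)%N)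
    k' l' (kln' : (k' + l' <= l)%N) k'' (kln'' : (k'' + l' <= n)%N)
    (w : n.-tuple A) :
  (k + k')%N = k'' -> subword kln' (subword kln w) = subword kln'' w.
Proof.
move=> e; apply: eq_from_tnth => j; rewrite !tnth_mktuple.
by congr tnth; apply: val_inj; rewrite /= -e addnA.
Qed.

Section Rauzy.
Variables (A : finType) (X : set (full_shift A)).

Definition rauzy_vertex n := {w : n.-tuple A | w \in language_of_length X n}.

Lemma subword_language n k l (kln : (k + l <= n)%N) (w : rauzy_vertex n) :
  subword kln (val w) \in language_of_length X l.
Proof.
case: w => w /= /set_mem[x [i [Xx ->]]]; apply/mem_set.
by exists x, (i + k%:Z)%R; rewrite subword_block.
Qed.

Definition rauzy_subword n k l (kln : (k + l <= n)%N) (w : rauzy_vertex n) :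
  rauzy_vertex l := to_set_type (subword_language kln w).

Lemma rauzy_subword_comp n k l (kln : (k + l <= n)%N)
    k' l' (kln' : (k' + l' <= l)%N) k'' (kln'' : (k'' + l' <= n)%N)
    (w : rauzy_vertex n) :
  (k + k')%N = k'' ->
  rauzy_subword kln' (rauzy_subword kln w) = rauzy_subword kln'' w.
Proof. by move=> e; apply: val_inj; apply: subword_subword. Qed.

(* Sigma_n(X) *)
Definition rauzy (n : nat) : digraph :=
  @Digraph (rauzy_vertex n) (rauzy_vertex n.+1)
    (rauzy_subword (leqnSn n : 0 + n <= n.+1)%N)
    (rauzy_subword (leqnn n.+1 : 1 + n <= n.+1)%N).

Lemma rauzy_proj_vertex_subproof n m :
  (n <= m)%N -> ((m - n) + n.*2 <= m.*2)%N.
Proof. by move=> nm; rewrite -!addnn addnA subnK // leq_add2l. Qed.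

Lemma rauzy_proj_edge_subproof n m :
  (n <= m)%N -> ((m - n) + n.*2.+1 <= m.*2.+1)%N.
Proof. by move=> nm; rewrite addnS ltnS rauzy_proj_vertex_subproof. Qed.

Section Projection.
Variables (n m : nat) (nm : (n <= m)%N).

Lemma rauzy_proj_source (e : edge (rauzy m.*2)) :
  source (rauzy_subword (rauzy_proj_edge_subproof nm) e : edge (rauzy n.*2)) =
  rauzy_subword (rauzy_proj_vertex_subproof nm) (source e).
Proof.
have h : ((m - n) + n.*2 <= m.*2.+1)%N.
  exact: leq_trans (rauzy_proj_vertex_subproof nm) (leqnSn _).
by rewrite /= !(rauzy_subword_comp _ _ h) ?addn0.
Qed.

Lemma rauzy_proj_target (e : edge (rauzy m.*2)) :
  target (rauzy_subword (rauzy_proj_edge_subproof nm) e : edge (rauzy n.*2)) =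
  rauzy_subword (rauzy_proj_vertex_subproof nm) (target e).
Proof.
have h : ((m - n).+1 + n.*2 <= m.*2.+1)%N.
  by rewrite addSn ltnS rauzy_proj_vertex_subproof.
by rewrite /= !(rauzy_subword_comp _ _ h) ?addn1.
Qed.

(* p_{m,n} : Sigma_2m(X) -> Sigma_2n(X) *)
Definition rauzy_proj : digraph_morphism (rauzy m.*2) (rauzy n.*2) :=
  DigraphMorphism rauzy_proj_source rauzy_proj_target.

End Projection.

Variables (x : full_shift A) (Xx : X x).

Lemma base_subproof n :
  block x (- n%:Z)%R n.*2 \in language_of_length X n.*2.
Proof. by apply/mem_set; exists x, (- n%:Z)%R. Qed.

(* the vertex x_[-n, n-1] of Sigma_2n(X) *)
Definition base n : vertex (rauzy n.*2) := to_set_type (base_subproof n).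

Lemma rauzy_proj_base n m (nm : (n <= m)%N) :
  vmap (rauzy_proj nm) (base m) = base n.
Proof.
apply: val_inj => /=; rewrite subword_block.
by rewrite -subzn // GRing.addrA GRing.addNr GRing.add0r.
Qed.

Definition hatPi n : Type :=
  @pro_local (fundamental_groupoid (rauzy n.*2)) (base n).

HB.instance Definition _ n := Topological.copy (hatPi n)
  (@pro_local (fundamental_groupoid (rauzy n.*2)) (base n)).
HB.instance Definition _ n := Group.copy (hatPi n)
  (@pro_local (fundamental_groupoid (rauzy n.*2)) (base n)).

Definition hatPi_map n m (nm : (n <= m)%N) : hatPi m -> hatPi n :=
  @pro_local_map _ _ (fundamental_functor (rauzy_proj nm)) _ _
    (rauzy_proj_base nm).

(* the index n stands for n + 1, as the Rauzy graphs Sigma_2n are indexed by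
   n >= 1 *)
Definition compatible : set (prod_topology (fun n => hatPi n.+1)) :=
  [set c | forall n m (nm : (n.+1 <= m.+1)%N), hatPi_map nm (c m) = c n].

Definition lim_hatPi : Type := set_type compatible.

HB.instance Definition _ := Topological.copy lim_hatPi (set_type compatible).

Lemma lim_one_subproof : (fun n => 1 : hatPi n.+1) \in compatible.
Proof. by apply/mem_set => n m nm; apply: pro_local_map1. Qed.

Lemma lim_mul_subproof (c d : lim_hatPi) :
  (fun n => val c n * val d n : hatPi n.+1) \in compatible.
Proof.
case: c d => c /= /set_mem cc [d /= /set_mem cd]; apply/mem_set => n m nm.
by rewrite -(cc _ _ nm) -(cd _ _ nm); apply: pro_local_mapM.
Qed.

Lemma lim_inv_subproof (c : lim_hatPi) :
  (fun n => (val c n)^-1 : hatPi n.+1) \in compatible.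
Proof.
case: c => c /= /set_mem cc; apply/mem_set => n m nm.
by rewrite -(cc _ _ nm); apply: pro_local_mapV.
Qed.

Definition lim_one : lim_hatPi := to_set_type lim_one_subproof.
Definition lim_mul (c d : lim_hatPi) : lim_hatPi :=
  to_set_type (lim_mul_subproof c d).
Definition lim_inv (c : lim_hatPi) : lim_hatPi :=
  to_set_type (lim_inv_subproof c).

Lemma lim_hatPiP (c d : lim_hatPi) : (forall n, val c n = val d n) -> c = d.
Proof. by move=> e; apply/val_inj/functional_extensionality_dep. Qed.

Lemma lim_mulA : associative lim_mul.
Proof. by move=> a b c; apply: lim_hatPiP => n; apply: mulgA. Qed.
Lemma lim_mul1g : left_id lim_one lim_mul.
Proof. by move=> a; apply: lim_hatPiP => n; apply: mul1g. Qed.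
Lemma lim_mulg1 : right_id lim_one lim_mul.
Proof. by move=> a; apply: lim_hatPiP => n; apply: mulg1. Qed.
Lemma lim_mulVg : left_inverse lim_one lim_inv lim_mul.
Proof. by move=> a; apply: lim_hatPiP => n; apply: mulVg. Qed.
Lemma lim_mulgV : right_inverse lim_one lim_inv lim_mul.
Proof. by move=> a; apply: lim_hatPiP => n; apply: mulgV. Qed.

HB.instance Definition _ := isGroup.Build lim_hatPi
  lim_mulA lim_mul1g lim_mulg1 lim_mulVg lim_mulgV.

End Rauzy.

(* Main.v *)
Require Import Defs.
From mathcomp Require Import fingroup perm.
From mathcomp Require Import all_boot all_order all_algebra.
From mathcomp Require Import all_classical reals topology.
From mathcomp Require Import zify.

Set Implicit Arguments.
Unset Strict Implicit.
Unset Printing Implicit Defensive.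

Local Open Scope classical_set_scope.
Local Open Scope quotient_scope.
Local Open Scope group_scope.

(** Let [F] be the free profinite semigroup and [e] the identity of the maximal
    subgroup [H] of the J-class of [X]. Since [e] is idempotent, it has infinitely
    many letters on each side; its prefixes and suffixes spell the two halves of a
    point [y] of [X] ([subgroup_point]). For each [n], an element of [H] between the
    left half and the right half of [y] labels a loop of the Rauzy graph of order
    [2 n] at the central vertex of [y], and concatenation of words corresponds to
    composition of loops. This gives a multiplicative map from [H] to the inverse
    limit of the profinite completions of the groups of loops, which after a change
    of base point is the isomorphism.

    More generally, a profinite word [k] joins [x] to [y] ([joins]) when the words
    close to [k] label paths from [x] to [y] in the Rauzy graphs of larger and
    larger order. Such a [k] always exists, by compactness ([joins_exists]), and
    conjugation by it moves the base point from [y] to an arbitrary [x].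

    The main fact about finite quotients is that, by uniform recurrence and the
    stability of finite semigroups, all long words of the language generate the
    same ideal, so that translation by one letter acts injectively between the
    R-classes of the values of long blocks ([letter_action]). It has two uses.
    First, [e r e] is invertible in [e F e], hence in [H], for all [r] that join
    [y] to itself ([joins_right_invertible], [locally_right_invertible]). Secondly,
    the translations extend to permutations of the finite quotient; they label the
    edges of a Rauzy graph by elements of a finite group, and the value of a loop
    then determines the translation by the word that labels it. Therefore the loop
    classes separate the elements of [H] ([path_class_separates]).

    In the other direction, each finite quotient of the fundamental groupoid of a
    connected graph is dominated by a labelling of the edges in a finite group
    ([congruence_label]), and the value of a word for such a labelling only depends
    on a finite quotient of [F] ([window_congruence]): the map is continuous. For
    its image, every vertex of a Rauzy graph of large order [2 m] contains a long
    central block of [x], so that the loops of this graph become, in the graph of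
    order [2 n], products of loops labelled by returns to that block and of their
    inverses ([loop_values]). Were the values of longer and longer returns not
    values of elements of [H], a cluster point [r] of these returns would
    contradict the membership of [e r e] in [H]. So [H] has the same image as the
    inverse limit in each finite quotient ([path_class_dense]).

    Separation and density together define the inverse map coordinate by
    coordinate. Its range is a subgroup containing [H], hence is [H] by
    maximality ([isomorphism_of_conjugation]). *)

(** * Topologies given by discrete coordinates *)

Lemma cvg_initial (S : choiceType) (T : topologicalType) (f : S -> T)
    (F : set_system S) (s : S) :
  Filter F -> f @ F --> f s -> F --> (s : initial_topology f).
Proof.
move=> FF cv U [_ /= [[W oW <-] Ws WU]]; apply: (filterS WU).
by apply: cv; apply: open_nbhs_nbhs.
Qed.

Lemma cvg_product (I : Type) (T : I -> topologicalType)
    (c : prod_topology T) (F : set_system (prod_topology T)) :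
  Filter F -> (forall i, (fun d : prod_topology T => d i) @ F --> c i) -> F --> c.
Proof. by move=> FF Fi; apply/cvg_sup => i; apply: cvg_initial; apply: Fi. Qed.

Lemma near_product (I : Type) (T : I -> topologicalType) (c : prod_topology T) i
    (U : set (T i)) : nbhs (c i) U -> nbhs c [set d | U (d i)].
Proof.
move=> cU; have : nbhs c --> c by [].
move=> /cvg_sup /(_ i) cv; apply: cv.
pose p (d : forall i, T i) := d i.
exact: (@initial_continuous _ _ p c U cU).
Qed.

Lemma cvg_coordinates (I : Type) (T : I -> choiceType)
    (c : prod_topology (fun i => discrete_topology (T i)))
    (F : set_system (prod_topology (fun i => discrete_topology (T i)))) :
  Filter F -> (forall i, F [set d | d i = c i]) -> F --> c.
Proof.
move=> FF Fi; apply: (@cvg_product _ (fun i => discrete_topology (T i))) => i.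
by apply/discrete_cvg; apply: Fi.
Qed.

Lemma near_coordinate (I : Type) (T : I -> choiceType)
    (c : prod_topology (fun i => discrete_topology (T i))) i :
  \forall d \near c, d i = c i.
Proof.
exact: (@near_product _ (fun i => discrete_topology (T i)) c i [set c i]
  (discrete_set1 _)).
Qed.

(** * Finite congruences *)

Section FiniteCongruences.

Lemma finite_code (T : choiceType) :
  finite_set [set: T] -> exists N (c : T -> 'I_N), injective c.
Proof.
move=> /finite_seqP[s sT].
have ins x : (index x s < size s)%N.
  by rewrite index_mem; have : [set: T] x by []; rewrite sT.
exists (size s), (fun x => Ordinal (ins x)) => x y [exy].
have xs z : z \in s by have : [set: T] z by []; rewrite sT.
by rewrite -(nth_index x (xs x)) exy nth_index.
Qed.

Lemma finite_setT_inj (T : choiceType) (U : finType) (c : T -> U) :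
  injective c -> finite_set [set: T].
Proof.
move=> ci; have h : {in [set: T] &, injective c} by move=> x y _ _; apply: ci.
rewrite -(eq_finite_set (inj_card_eq h)).
exact: finite_finset.
Qed.

Variable S : semigroupType.

Section Kernel.
Variables (T : finType) (f : S -> T).
Hypothesis fM : forall x x' y y',
  f x = f x' -> f y = f y' -> f (x * y) = f (x' * y').

Definition kernel_rel : rel S := fun x y => f x == f y.

Lemma kernel_refl : reflexive kernel_rel.
Proof. by move=> x; apply: eqxx. Qed.

Lemma kernel_sym : symmetric kernel_rel.
Proof. by move=> x y; apply: eq_sym. Qed.

Lemma kernel_trans : transitive kernel_rel.
Proof. by move=> y x z /eqP xy /eqP yz; apply/eqP; rewrite xy. Qed.

Definition kernel_equiv : equiv_rel S :=
  EquivRel kernel_rel kernel_refl kernel_sym kernel_trans.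

Lemma kernel_mul x x' y y' : kernel_equiv x x' -> kernel_equiv y y' ->
  kernel_equiv (x * y) (x' * y').
Proof. by move=> /eqP xx' /eqP yy'; apply/eqP/fM. Qed.

Lemma kernel_finite : finite_set [set: {eq_quot kernel_equiv}].
Proof.
pose c (a : {eq_quot kernel_equiv}) := f (repr a).
apply: (@finite_setT_inj _ _ c) => a b /eqP ab.
by rewrite -[a]reprK -[b]reprK; apply/eqquotP.
Qed.

Definition kernel_congruence : finite_congruence S :=
  FiniteCongruence kernel_mul kernel_finite.

Lemma kernel_congruenceP x y : kernel_congruence x y <-> f x = f y.
Proof. by split=> [/eqP|/eqP]. Qed.

End Kernel.

(** Congruences are combined by pairing their codes, the quotients not being
    instances of finite types. *)
Lemma congruence_code (t : finite_congruence S) :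
  exists N (c : S -> 'I_N), forall x y, t x y <-> c x = c y.
Proof.
have [N [c ci]] := finite_code (cong_finite t).
exists N, (fun x => c (\pi_(quot t) x)) => x y; rewrite -quot_piE.
by split=> [->//|/ci].
Qed.

Lemma congruence_meet (t1 t2 : finite_congruence S) :
  exists t : finite_congruence S, forall x y, t x y -> t1 x y /\ t2 x y.
Proof.
have [N1 [c1 c1P]] := congruence_code t1.
have [N2 [c2 c2P]] := congruence_code t2.
have fM x x' y y' : (c1 x, c2 x) = (c1 x', c2 x') ->
    (c1 y, c2 y) = (c1 y', c2 y') ->
    (c1 (x * y), c2 (x * y)) = (c1 (x' * y'), c2 (x' * y')).
  move=> [/c1P a /c2P b] [/c1P c /c2P d].
  by congr pair; [apply/c1P|apply/c2P]; apply: congM.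
exists (@kernel_congruence _ (fun x => (c1 x, c2 x)) fM) => x y.
by move=> /kernel_congruenceP[/c1P ? /c2P ?].
Qed.

End FiniteCongruences.

(** * Points of the profinite completion *)

Section Completion.
Variable S : semigroupType.
Implicit Types (k l : semigroup_completion S) (t : finite_congruence S).

Definition at_ t k : quot t := val k t.

Definition approx t k (w : S) : Prop := at_ t k = \pi_(quot t) w.

Lemma at_mul t k l : at_ t (k * l) = at_ t k * at_ t l.
Proof. by []. Qed.

Lemma completionP k l : (forall t, at_ t k = at_ t l) -> k = l.
Proof. by move=> e; apply/val_inj/functional_extensionality_dep. Qed.

Lemma at_coarser t t' k : (forall x y, t x y -> t' x y) ->
  at_ t' k = \pi_(quot t') (repr (at_ t k)).
Proof. by case: k => c cc le; rewrite /at_ /= -(set_mem cc _ _ le). Qed.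

Lemma approx_repr t k : approx t k (repr (at_ t k)).
Proof. by rewrite /approx reprK. Qed.

Lemma approxM t k l w v : approx t k w -> approx t l v -> approx t (k * l) (w * v).
Proof. by rewrite /approx at_mul => -> ->; apply: quot_mulE. Qed.

Lemma approx_coarser t t' k w :
  (forall x y, t x y -> t' x y) -> approx t k w -> approx t' k w.
Proof.
move=> le kw; rewrite /approx (at_coarser k le); apply/quot_piE/le.
by rewrite kw; apply: quot_repr.
Qed.

Lemma approx_cong t k w v : approx t k w -> approx t k v <-> t w v.
Proof.
rewrite /approx => ->; exact: quot_piE.
Qed.

Lemma approx_eq t k l w : approx t k w -> approx t l w -> at_ t k = at_ t l.
Proof. by rewrite /approx => -> ->. Qed.

Lemma near_at t k : \forall l \near k, at_ t l = at_ t k.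
Proof.
exact: (@initial_continuous _ _ (@set_val _ (@coherent S)) k
  [set d | d t = val k t] (near_coordinate _ t)).
Qed.

Lemma cvg_completion l (F : set_system (semigroup_completion S)) :
  Filter F -> (forall t, F [set k | at_ t k = at_ t l]) -> F --> l.
Proof.
by move=> FF Ft; apply: cvg_initial; apply: cvg_coordinates => t; apply: Ft.
Qed.

Lemma closure_approx (L : set S) k t :
  closure (completion_eta @` L) k -> exists2 w, L w & approx t k w.
Proof.
move=> /(_ _ (near_at t k)) [_ [[w Lw <-] kw]].
by exists w => //; rewrite /approx -kw.
Qed.

(** Compactness: an ultrafilter finer than the Frechet filter selects one class in
    each finite quotient, and these classes are coherent. *)
Lemma cluster_point (k : nat -> semigroup_completion S) :
  exists l, forall t M, exists2 n, (M <= n)%N & at_ t (k n) = at_ t l.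
Proof.
have [G [GU Ginf]] := ultraFilterLemma (F := \oo) _.
have lim t : exists a, G [set n | at_ t (k n) = a].
  have /finite_seqP[s sT] := cong_finite t.
  have : G [set n | at_ t (k n) \in s].
    apply: filterS filterT => n _ /=.
    by have : [set: {eq_quot t}] (at_ t (k n)) by []; rewrite sT.
  elim: (s) => [|a s' IH].
    move=> G0; have [n] := @filter_ex _ _ _ _ G0; by rewrite /= in_nil.
  move=> Gs; have [Ga|Gna] := in_ultra_setVsetC [set n | at_ t (k n) = a] GU.
    by exists a.
  apply: IH; apply: filterS (filterI Gs Gna) => n /= [].
  by rewrite in_cons => /orP[/eqP|].
pose c t := projT1 (cid (lim t)).
have cP t : G [set n | at_ t (k n) = c t] by rewrite /c; case: cid.
have cc : c \in @coherent S.
  apply/mem_set => t t' le.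
  have [n [e e']] := filter_ex (filterI (cP t) (cP t')).
  by rewrite -e -e' (at_coarser (k n) le).
exists (to_set_type cc) => t M.
have GM : G [set n | (M <= n)%N] by apply: Ginf; exists M.
have [n [e Mn]] := filter_ex (filterI (cP t) GM).
by exists n.
Qed.

End Completion.

(** * Bi-infinite sequences and window products *)

Section Sequences.
Variable A : finType.
Implicit Types (x y z : full_shift A) (w : seq A).

Definition shl (N : int) z : full_shift A := fun i => z (i + N)%R.

Definition agree (a b : int) z z' := forall i : int, (a <= i < b)%R -> z i = z' i.

(** The left half of [x], then [w], then the right half of [y]. *)
Definition splice x w y : full_shift A := fun i =>
  match i with
  | Posz k => if (k < size w)%N then nth (x 0%R) w k else y (k - size w)%N
  | Negz _ => x i
  end.

Lemma shl0 z : shl 0 z = z.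
Proof. by apply/funext => i; rewrite /shl GRing.addr0. Qed.

Lemma shl_shl M N z : shl M (shl N z) = shl (M + N) z.
Proof. by apply/funext => i; rewrite /shl GRing.addrA. Qed.

Lemma agree_sym a b z z' : agree a b z z' -> agree a b z' z.
Proof. by move=> h i /h. Qed.

Lemma agree_trans a b z1 z2 z3 : agree a b z1 z2 -> agree a b z2 z3 -> agree a b z1 z3.
Proof. by move=> h h' i ai; rewrite h ?h'. Qed.

Lemma agree_sub a b a' b' z z' : agree a' b' z z' ->
  (a' <= a)%R -> (b <= b')%R -> agree a b z z'.
Proof. by move=> h aa bb i ai; apply: h; lia. Qed.

Lemma agree_shl a b N z z' :
  agree (a + N)%R (b + N)%R z z' -> agree a b (shl N z) (shl N z').
Proof. by move=> h i ai; apply: h; lia. Qed.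

Lemma block_agree i n z z' : agree i (i + n%:Z)%R z z' <-> block z i n = block z' i n.
Proof.
split=> [h|e k ik].
  by apply: eq_from_tnth => k; rewrite !tnth_mktuple h //; have := ltn_ord k; lia.
have kn : (absz (k - i) < n)%N by lia.
have := congr1 (fun t => tnth t (Ordinal kn)) e; rewrite !tnth_mktuple /=.
by have -> : (i + `|(k - i)%R|%N = k)%R by lia.
Qed.

Lemma eq_block z i j n : i = j -> block z i n = block z j n.
Proof. by move=> ->. Qed.

Lemma block_shl N z i n : block (shl N z) i n = block z (i + N)%R n.
Proof.
by apply: eq_from_tnth => k; rewrite !tnth_mktuple /shl; congr z; lia.
Qed.

Lemma nth_block a z i n k : (k < n)%N -> nth a (block z i n) k = z (i + k%:Z)%R.
Proof. by move=> kn; rewrite -(tnth_nth a _ (Ordinal kn)) tnth_mktuple. Qed.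

Lemma block_cat z i n m :
  block z i (n + m) = block z i n ++ block z (i + n%:Z)%R m :> seq A.
Proof.
apply: (@eq_from_nth _ (z 0%R)); rewrite ?size_cat !size_tuple // => k kn.
rewrite nth_block // nth_cat size_tuple; case: ltnP => h.
  by rewrite nth_block.
by rewrite nth_block; [congr z|]; lia.
Qed.

(** The left context only matters on the left, hence the arbitrary [x']. *)
Lemma splice_cat x w w' y x' :
  splice x (w ++ w') y = splice x w (splice x' w' y).
Proof.
apply/funext => -[k|//] /=; rewrite size_cat nth_cat.
case: (ltnP k (size w)) => kw; first by rewrite ltn_addr.
rewrite ltn_subLR //; case: (ltnP k) => kw'; last by rewrite subnDA.
by apply: set_nth_default; rewrite ltn_subLR.
Qed.

Lemma shl_splice_cat x w w' y y' :
  shl (size w) (splice x (w ++ w') y) = splice (shl (size w) (splice x w y')) w' y.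
Proof.
apply/funext => -[k|k]; rewrite /shl.
  rewrite -PoszD /= size_cat nth_cat [(k + _)%N]addnC ltn_add2l.
  rewrite [(_ + k < _)%N]ltnNge leq_addr addKn /=.
  case: (ltnP k) => kw; first exact: set_nth_default.
  by rewrite subnDl.
case: (ltnP k (size w)) => kw.
  have e : (Negz k + size w)%R = (size w - k.+1)%N by rewrite NegzE; lia.
  have h : (size w - k.+1 < size w)%N by lia.
  by rewrite e /= /shl e /= size_cat nth_cat h ltn_addr.
have e : (Negz k + size w)%R = Negz (k - size w)%N by rewrite !NegzE; lia.
by rewrite e /= /shl e.
Qed.

Lemma splice_agree a b x x' w y y' : agree a 0 x x' ->
  agree 0 (b - (size w)%:Z)%R y y' ->
  agree a b (splice x w y) (splice x' w y').
Proof.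
move=> hx hy [k|k] /= kab; last by apply: hx; lia.
case: ltnP => kw; first exact: set_nth_default.
by apply: hy; lia.
Qed.

Lemma splice_block z N : splice z (block z 0 N) (shl N z) = z.
Proof.
apply/funext => -[k|//]; rewrite /splice size_tuple; case: ltnP => kN.
  by rewrite nth_block // GRing.add0r.
by rewrite /shl; congr z; lia.
Qed.

End Sequences.

Section WindowProduct.
Variables (A : finType) (T : Type) (idx : T) (op : Monoid.law idx) (n : nat).
Variable lam : n.*2.+1.-tuple A -> T.
Implicit Types (x y z : full_shift A) (w : seq A).

(** The monoid is arbitrary because the same product serves three times: with
    labels in a group it is the value of a path of a Rauzy graph, with boolean
    labels it says that the path exists, with labels in lists it is the path. *)
Fixpoint wprod z N : T :=
  if N is N'.+1 then op (lam (block z (- n%:Z)%R n.*2.+1)) (wprod (shl 1 z) N')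
  else idx.

Lemma wprod_add z N M : wprod z (N + M) = op (wprod z N) (wprod (shl N z) M).
Proof.
elim: N z => [|N IH] z /=; first by rewrite Monoid.mul1m shl0.
by rewrite IH Monoid.mulmA shl_shl; have -> : (N%:Z + 1 = N.+1%:Z)%R by lia.
Qed.

Lemma wprod_agree z z' N :
  agree (- n%:Z)%R (N%:Z + n%:Z)%R z z' -> wprod z N = wprod z' N.
Proof.
elim: N z z' => [//|N IH] z z' zz' /=; congr (op (lam _) _).
  by apply/block_agree; apply (agree_sub zz'); lia.
by apply: (IH (shl 1 z) (shl 1 z')); apply (agree_shl (N:=1)); apply (agree_sub zz'); lia.
Qed.

Definition splice_prod x w y := wprod (splice x w y) (size w).

Lemma splice_prod_cat x w w' y x' y' :
  splice_prod x (w ++ w') y =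
  op (splice_prod x w (splice x' w' y))
     (splice_prod (shl (size w) (splice x w y')) w' y).
Proof.
by rewrite /splice_prod size_cat wprod_add -shl_splice_cat -splice_cat.
Qed.

Lemma splice_prod_agree x x' w y y' : agree (- n%:Z)%R 0 x x' ->
  agree 0 n y y' -> splice_prod x w y = splice_prod x' w y'.
Proof.
move=> hx hy; apply: wprod_agree; apply: splice_agree => //.
by apply (agree_sub hy); lia.
Qed.

End WindowProduct.

(** * Finite congruences that see windows *)

Section SpliceEnds.
Variables (A : finType) (n : nat).
Implicit Types (x y z : full_shift A) (w : seq A).

Lemma take_eq_cases w w' : take n w = take n w' ->
  w = w' \/ (n <= size w)%N /\ (n <= size w')%N.
Proof.
move=> e; have := congr1 size e; rewrite !size_take.
case: (ltnP n (size w)) => nw; case: (ltnP n (size w')) => nw' es; try by right; lia.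
by left; move: e; rewrite !take_oversize.
Qed.

Lemma splice_prefix x w y k : (k < size w)%N -> splice x w y k = nth (x 0%R) w k.
Proof. by move=> kw; rewrite /= kw. Qed.

Lemma splice_suffix x w y k : (k < size w)%N ->
  shl (size w) (splice x w y) (Negz k) = nth (x 0%R) (rev w) k.
Proof.
move=> kw; have e : (Negz k + size w)%R = (size w - k.+1)%N by rewrite NegzE; lia.
by rewrite /shl e splice_prefix ?nth_rev //; lia.
Qed.

Lemma splice_take x w w' y y' : take n w = take n w' ->
  ((n <= size w)%N \/ agree 0 n y y') ->
  agree 0 n (splice x w y) (splice x w' y').
Proof.
move=> e hy; have [ww|[nw nw']] := take_eq_cases e.
  subst w'; have [nw|yy] : (n <= size w)%N \/ agree 0 n y y' by [].
    by move=> [k|k] kn; rewrite ?splice_prefix //; lia.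
  by apply: splice_agree => //; apply (agree_sub yy); lia.
move=> [k|k] kn; last lia.
rewrite !splice_prefix; try lia.
by rewrite -(nth_take _ (n0 := n)) ?e ?nth_take //; lia.
Qed.

Lemma splice_take_rev x x' w w' y y' : take n (rev w) = take n (rev w') ->
  ((n <= size w)%N \/ agree (- n%:Z)%R 0 x x') ->
  agree (- n%:Z)%R 0 (shl (size w) (splice x w y)) (shl (size w') (splice x' w' y')).
Proof.
move=> e hx; have [/(congr1 rev)|] := take_eq_cases e.
  rewrite !revK => ww; subst w'; move=> [k|k] kn; first lia.
  case: (ltnP k (size w)) => kw.
    by rewrite !splice_suffix //; apply: set_nth_default; rewrite size_rev.
  have -> z : shl (size w) z (Negz k) = z (Negz (k - size w)%N).
    by rewrite /shl; congr z; rewrite !NegzE; lia.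
  have -> z : shl (size w) z (Negz k) = z (Negz (k - size w)%N).
    by rewrite /shl; congr z; rewrite !NegzE; lia.
  rewrite /=; case: hx => [nw|]; first lia.
  by apply; rewrite NegzE; lia.
rewrite !size_rev => -[nw nw'] [k|k] kn; first lia.
rewrite !splice_suffix; try lia.
rewrite -[LHS](nth_take _ (n0 := n)); last lia.
rewrite e nth_take; last lia.
have kn' : (k < n)%N by lia.
by apply: set_nth_default; rewrite size_rev; apply: leq_trans nw'.
Qed.

End SpliceEnds.

Section WindowCongruence.
Variables (A : finType) (a0 : A) (T : choiceType) (idx : T) (op : Monoid.law idx).
Variables (finT : finite_set [set: T]) (n : nat) (lam : n.*2.+1.-tuple A -> T).
Implicit Types (x y z : full_shift A) (w : seq A).

(* Only the letters at distance at most n from the word matter, so that finitely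
   many contexts are representative. *)
Let context (c : (n + n).-tuple A) : full_shift A :=
  fun i => nth a0 c (absz (i + n)%R).

Let context_block z : agree (- n%:Z)%R n (context (block z (- n%:Z)%R (n + n))) z.
Proof.
move=> i hi; rewrite /context nth_block; last lia.
by congr z; lia.
Qed.

Lemma take_cat_eq w v w' v' : take n w = take n w' -> take n v = take n v' ->
  take n (w ++ v) = take n (w' ++ v').
Proof.
have take2 (s s' : seq A) : take n (s ++ s') = take n (take n s ++ take n s').
  rewrite take_cat [RHS]take_cat size_take; case: (ltnP n (size s)) => ns.
    by rewrite ltnn subnn take0 cats0.
  rewrite ltnNge ns /= [take n s]take_oversize //; congr cat.
  by rewrite take_takel //; lia.
by move=> ww vv; rewrite take2 ww vv -take2.
Qed.

(** By [splice_prod_cat], the value of a product of words is determined by the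
    values of the factors in all contexts and by their prefixes and suffixes of
    length [n], which complete the contexts. *)
Lemma window_congruence : exists t : finite_congruence (word A),
  forall w w' : word A, t w w' ->
  [/\ take n w = take n w', take n (rev w) = take n (rev w') &
      forall x y, splice_prod op lam x w y = splice_prod op lam x w' y].
Proof.
have [N [code codeI]] := finite_code finT.
have take_le w : (size (take n w) <= n)%N by rewrite size_take; case: ltnP; lia.
pose f (w : word A) := (Bseq (take_le w), Bseq (take_le (rev w)),
  [ffun c => code (splice_prod op lam (context c) w (context c))]).
have fP (w w' : word A) : f w = f w' <->
    [/\ take n w = take n w', take n (rev w) = take n (rev w') &
      forall x y, splice_prod op lam x w y = splice_prod op lam x w' y].
  split=> [[e1 e2 /ffunP e3]|[e1 e2 e3]]; last first.
    congr (_, _, _); [exact: val_inj|exact: val_inj|].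
    by apply/ffunP => c; rewrite !ffunE e3.
  split=> // x y; have := e3 (block (splice x [::] y) (- n%:Z)%R (n + n)).
  rewrite !ffunE => /codeI; set c := context _ => ec.
  have cx : agree (- n%:Z)%R 0 c x.
    move=> i hi; rewrite /c context_block; last lia.
    by case: i hi => [k|//]; lia.
  have cy : agree 0 n c y.
    move=> i hi; rewrite /c context_block; last lia.
    by case: i hi => [k _|//] /=; rewrite subn0.
  by rewrite -(splice_prod_agree op lam w cx cy) ec; apply: splice_prod_agree.
have fM (w w' v v' : word A) : f w = f w' -> f v = f v' -> f (w * v) = f (w' * v').
  move=> /fP[w1 w2 w3] /fP[v1 v2 v3]; apply/fP; split.
  - exact: take_cat_eq.
  - by rewrite !rev_cat; apply: take_cat_eq.
  - move=> x y; rewrite /= !(splice_prod_cat op lam x _ _ y x x) w3 -v3.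
    congr (op _ _).
      apply: splice_prod_agree => //; apply: splice_take => //.
      by right.
    by apply: splice_prod_agree => //; apply: splice_take_rev => //; right.
exists (kernel_congruence fM) => w w' /kernel_congruenceP; exact: (fP _ _).1.
Qed.

End WindowCongruence.

(** * Minimal subshifts *)

Section Subshift.
Variables (A : finType) (X : set (full_shift A)).
Implicit Types (x y z : full_shift A) (w : seq A).

Lemma near_agree (M : nat) y : \forall z \near y, agree (- M%:Z)%R M z y.
Proof.
have FF := nbhs_filter (y : {ptws int -> discrete_topology A}).
elim: M => [|M IH].
  by apply: (@filterS _ _ FF setT) (@filterT _ _ FF) => z _ i; lia.
pose c i := @near_coordinate int (fun=> A) y i.
have c2 := @filterI _ _ FF _ _ (c (Posz M)) (c (Negz M)).
apply: (@filterS _ _ FF) (@filterI _ _ FF _ _ IH c2) => z [h [h1 h2]].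
move=> i hi.
have [->//|iM] := eqVneq i (Posz M); have [->//|iM'] := eqVneq i (Negz M).
by apply: h; lia.
Qed.

Lemma closed_agree y : closed X ->
  (forall M : nat, exists2 z, X z & agree (- M%:Z)%R M z y) -> X y.
Proof.
move=> cX h; have zP M : {z | X z /\ agree (- M%:Z)%R M z y}.
  by apply: cid; have [z Xz zy] := h M; exists z.
pose z M : full_shift A := projT1 (zP M).
have Xz M : X (z M) by rewrite /z; case: (zP M) => ? [].
have zy M : agree (- M%:Z)%R M (z M) y by rewrite /z; case: (zP M) => ? [].
apply: (closed_cvg (F := \oo) (u_ := z) X cX); first by apply: nearW.
apply: cvg_coordinates => i; exists (absz i).+1 => // M /= iM.
by apply: zy; lia.
Qed.

Hypothesis subX : subshift X.

Lemma subshift_shl N z : X z -> X (shl N z).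
Proof.
case: subX => _ _ sX.
have fwd y : X y -> X (shl 1 y) by move=> Xy; rewrite -sX; exists y.
have bwd y : X y -> X (shl (-1) y).
  rewrite -{1}sX => -[y' Xy' <-].
  by have -> : shl (-1) (shift y') = y'; first by
    apply/funext => i; rewrite /shl /shift; congr y'; lia.
case: N => N; elim: N z => [|N IH] z Xz.
- by rewrite shl0.
- have -> : Posz N.+1 = (N%:Z + 1)%R by lia.
  by rewrite -shl_shl; apply/IH/fwd.
- exact: bwd.
- have -> : Negz N.+1 = (Negz N + - 1)%R by rewrite !NegzE; lia.
  by rewrite -shl_shl; apply/IH/bwd.
Qed.

Lemma language_recenter n (u : n.-tuple A) (i : int) :
  language_of_length X n u -> exists2 z, X z & u = block z i n.
Proof.
move=> [z [j [Xz ->]]]; exists (shl (j - i) z); first exact: subshift_shl.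
by rewrite block_shl; apply: eq_block; lia.
Qed.

Lemma full_shift_cluster (z : nat -> full_shift A) :
  exists y, forall (M : nat), exists2 N, (M <= N)%N & agree (- M%:Z)%R M (z N) y.
Proof.
have [G [GU Ginf]] := ultraFilterLemma (F := \oo) _.
have lim i : exists a, G [set N | z N i = a].
  have : G [set N | z N i \in enum A].
    by apply: filterS filterT => N _ /=; rewrite mem_enum.
  elim: (enum A) => [|a s IH].
    by move=> G0; have [N] := @filter_ex _ _ _ _ G0; rewrite /= in_nil.
  move=> Gs; have [Ga|Gna] := in_ultra_setVsetC [set N | z N i = a] GU.
    by exists a.
  apply: IH; apply: filterS (filterI Gs Gna) => N /= [].
  by rewrite in_cons => /orP[/eqP|].
have {}lim i : {a | G [set N | z N i = a]} by apply: cid.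
exists (fun i => projT1 (lim i)) => M.
have GM : G [set N | (M <= N)%N] by apply: Ginf; exists M.
suff GA : G [set N | agree (- M%:Z)%R M (z N) (fun i => projT1 (lim i))].
  by have [N [MN h]] := filter_ex (filterI GM GA); exists N.
elim: (M) => [|M' IH]; first by apply: filterS filterT => N _ i; lia.
have g i : G [set N | z N i = projT1 (lim i)] by case: (lim i).
apply: filterS (filterI IH (filterI (g (Posz M')) (g (Negz M')))) => N /= [h [h1 h2]].
move=> i hi.
have [->//|iM] := eqVneq i (Posz M'); have [->//|iM'] := eqVneq i (Negz M').
by apply: h; lia.
Qed.

End Subshift.

Section Minimal.
Variables (A : finType) (X : set (full_shift A)).
Hypothesis minX : minimal_subshift X.
Implicit Types (x y z : full_shift A).

Let subX : subshift X. Proof. by case: minX. Qed.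

(** If [u] does not occur in arbitrarily long blocks of points of [X], these blocks
    accumulate at a point that avoids [u], and the points avoiding [u] form a
    proper subshift. *)
Lemma uniform_recurrence n (u : n.-tuple A) : language_of_length X n u ->
  exists N, forall z, X z -> exists2 i : nat, (i < N)%N & block z i n = u.
Proof.
move=> Lu; apply: contrapT => nrec.
have h M : {z | X z /\ forall i : int, (`|i| <= M)%N -> block z i n != u}.
  apply: cid; apply: contrapT => nz; apply: nrec; exists (M + M).+1 => z Xz.
  apply: contrapT => nb; apply: nz; exists (shl M z); split.
    exact: subshift_shl.
  move=> i iM; apply/eqP => e; apply: nb; exists (absz (i + M)%R); first lia.
  by rewrite -e block_shl; apply: eq_block; lia.
have [y yP] := full_shift_cluster (fun M => projT1 (h M)).
pose Y := [set z | X z /\ forall i, block z i n != u].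
have Yy : Y y.
  split.
    case: subX => _ cX _; apply: (closed_agree cX) => M.
    by have [N _ a] := yP M; exists (projT1 (h N)) => //; case: (h N) => ? [].
  move=> i; have [N MN a] := yP (absz i + n)%N.
  have -> : block y i n = block (projT1 (h N)) i n.
    by apply/block_agree; apply/agree_sym; apply (agree_sub a); lia.
  by have [_ zu] := projT2 (h N); apply: zu; lia.
have subY : subshift Y.
  split; first by exists y.
    move=> z cz; split.
      case: subX => _ cX _; apply: cX => B /cz[z' [[Xz' _] Bz']].
      by exists z'.
    move=> i; have [z' [[_ zu] a]] := cz _ (near_agree (absz i + n) z).
    have <- : block z' i n = block z i n.
      by apply/block_agree; apply (agree_sub a); lia.
    exact: zu.
  apply/seteqP; split=> [_ [z [Xz zu] <-]|z [Xz zu]].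
    split; first exact: (subshift_shl subX 1).
    by move=> i; have := zu (i + 1)%R; rewrite -block_shl.
  exists (shl (-1) z).
    by split=> [|i]; [exact: subshift_shl|rewrite block_shl].
  by apply/funext => i; rewrite /shift /shl; congr z; lia.
have YX : Y = X by case: minX => _; apply=> // z [].
have [z [i [Xz uz]]] := Lu.
have [_ /(_ i)] : Y z by rewrite YX.
by rewrite uz eqxx.
Qed.

End Minimal.

(** * Eventual properties of the approximations of a profinite element *)

Section Eventually.
Variable S : semigroupType.
Implicit Types (k l : semigroup_completion S) (t : finite_congruence S).
Implicit Types (Q R : S -> Prop).

(** Elements of the completion are handled through the words close to them: [Q]
    holds on the trace of a neighbourhood of [k] on the dense subsemigroup. *)
Definition eventually_approx k Q := exists t, forall w, approx t k w -> Q w.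

(** The closure of such a set of words in the completion is open and closed. *)
Definition recognizable Q := exists t : finite_congruence S,
  forall w w', t w w' -> Q w -> Q w'.

Lemma ev_approx t k : eventually_approx k (approx t k).
Proof. by exists t. Qed.

Lemma evS Q R k : (forall w, Q w -> R w) ->
  eventually_approx k Q -> eventually_approx k R.
Proof. by move=> QR [t h]; exists t => w /h /QR. Qed.

Lemma evI Q R k : eventually_approx k Q -> eventually_approx k R ->
  eventually_approx k (fun w => Q w /\ R w).
Proof.
move=> [t h] [t' h']; have [t'' le] := congruence_meet t t'.
exists t'' => w kw; split.
  by apply/h/(approx_coarser _ kw) => x y /le[].
by apply/h'/(approx_coarser _ kw) => x y /le[].
Qed.

Lemma ev_ex Q k : eventually_approx k Q -> exists w, Q w.
Proof. by move=> [t h]; exists (repr (at_ t k)); apply/h/approx_repr. Qed.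

Lemma ev_exists Q k t : eventually_approx k Q -> exists2 w, Q w & approx t k w.
Proof. by move=> /evI /(_ (ev_approx t k)) /ev_ex[w []]; exists w. Qed.

Lemma recognizable_ev Q k : recognizable Q ->
  (forall t, exists2 w, Q w & approx t k w) -> eventually_approx k Q.
Proof.
move=> [t h] /(_ t) [w Qw kw]; exists t => w' kw'; apply: h Qw.
by apply/(approx_cong _ kw).
Qed.

(** Multiplication is continuous: a recognizable property of products of
    approximations is one of the approximations of the product. *)
Lemma recognizable_evM Q Q1 Q2 k l : recognizable Q ->
  eventually_approx k Q1 -> eventually_approx l Q2 ->
  (forall w v, Q1 w -> Q2 v -> Q (w * v)) -> eventually_approx (k * l) Q.
Proof.
move=> rQ k1 l2 Q12; apply: recognizable_ev => // t.
have [w Q1w kw] := ev_exists t k1; have [v Q2v lv] := ev_exists t l2.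
by exists (w * v); [apply: Q12|apply: approxM].
Qed.

Lemma ev_eta Q w : eventually_approx (completion_eta w) Q -> Q w.
Proof. by move=> [t]; apply. Qed.

Lemma ev_eta_recognizable Q w :
  recognizable Q -> Q w -> eventually_approx (completion_eta w) Q.
Proof. by move=> rQ Qw; apply: recognizable_ev => // t; exists w. Qed.

Lemma cluster_ev (k : nat -> semigroup_completion S) :
  exists l, forall Q, eventually_approx l Q ->
    forall M, exists2 n, (M <= n)%N & eventually_approx (k n) Q.
Proof.
have [l lP] := cluster_point k; exists l => Q [t h] M.
have [n Mn e] := lP t M; exists n => //; exists t => w nw; apply: h.
by rewrite /approx -e.
Qed.

Lemma recognizable_or Q k : recognizable Q ->
  eventually_approx k Q \/ eventually_approx k (fun w => ~ Q w).
Proof.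
move=> [t h]; have kw := approx_repr t k.
have [Qw|nQw] := pselect (Q (repr (at_ t k))); [left|right]; exists t => v kv.
  by apply: h Qw; apply/(approx_cong _ kw).
by move=> Qv; apply: nQw; apply: h Qv; apply/(approx_cong _ kv).
Qed.

Lemma recognizable_cluster Q (k : nat -> semigroup_completion S) l M :
  (forall R, eventually_approx l R ->
    forall M, exists2 n, (M <= n)%N & eventually_approx (k n) R) ->
  recognizable Q -> (forall n, (M <= n)%N -> eventually_approx (k n) Q) ->
  eventually_approx l Q.
Proof.
move=> lP rQ kQ; have [//|lnQ] := recognizable_or l rQ.
have [n Mn knQ] := lP _ lnQ M.
by have [w []] := ev_ex (evI (kQ _ Mn) knQ).
Qed.

End Eventually.

(** * Words joining two points of a subshift *)

Section Good.
Variables (A : finType) (X : set (full_shift A)).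
Implicit Types (x y z : full_shift A) (w : seq A).

Lemma language_sub z (a b : int) m m' : (a <= b)%R -> (b + m'%:Z <= a + m%:Z)%R ->
  language_of_length X m (block z a m) -> language_of_length X m' (block z b m').
Proof.
move=> ab bm [z' [i [Xz e]]]; exists z', (i + (b - a))%R; split => //.
apply: eq_from_tnth => k; rewrite !tnth_mktuple.
have km : (absz (b - a) + k < m)%N by have := ltn_ord k; lia.
have := congr1 (fun t => tnth t (Ordinal km)) e; rewrite !tnth_mktuple /=.
by congr (_ = _); [congr z|congr z']; lia.
Qed.

Definition in_language n (u : n.*2.+1.-tuple A) : bool :=
  u \in language_of_length X n.*2.+1.

Definition admissible n z N := wprod andb (in_language (n := n)) z N.

Lemma admissibleP n z N : admissible n z N <-> forall i : nat, (i < N)%N ->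
  language_of_length X n.*2.+1 (block z (i%:Z - n%:Z)%R n.*2.+1).
Proof.
elim: N z => [|N IH] z //; rewrite /admissible /=; split.
  move=> /andP[/set_mem h0 /IH h] [|i] iN.
    by move: h0; rewrite GRing.add0r.
  by have := h i iN; rewrite block_shl; congr (_ (block _ _ _)); lia.
move=> h; apply/andP; split.
  by apply/mem_set; have := h 0 isT; rewrite GRing.add0r.
apply/IH => i iN; rewrite block_shl.
by have := h i.+1 iN; congr (_ (block _ _ _)); lia.
Qed.

(** The bi-infinite word obtained by inserting [w] between the left half of [x]
    and the right half of [y] cannot be told apart from [x] at its origin nor
    from [y] at the end of [w], nor from [X] in between, through windows of
    radius [n]: [w] labels a path of the Rauzy graph of order [2 n] from
    the central vertex of [x] to that of [y]. *)
Definition good (n : nat) x y w :=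
  [/\ agree 0 n (splice x w y) x,
      agree (- n%:Z)%R 0 (shl (size w) (splice x w y)) y &
      admissible n (splice x w y) (size w)].

Lemma good_le n m x y w : (n <= m)%N -> good m x y w -> good n x y w.
Proof.
move=> nm [h1 h2 h3]; split.
- by apply (agree_sub h1); lia.
- by apply (agree_sub h2); lia.
- apply/admissibleP => i iw; have /admissibleP/(_ i iw) := h3.
  by apply: language_sub; lia.
Qed.

Section Product.
Variables (T : Type) (idx : T) (op : Monoid.law idx) (n : nat).
Variable lam : n.*2.+1.-tuple A -> T.

(** Goodness says that [y] is a correct right context for [w] and a correct left
    context for [w'], up to distance [n]. *)
Lemma splice_prod_good x y z w w' : good n x y w -> good n y z w' ->
  splice_prod op lam x (w ++ w') z =
  op (splice_prod op lam x w y) (splice_prod op lam y w' z).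
Proof.
move=> [_ h2 _] [h1 _ _]; rewrite (splice_prod_cat op lam x w w' z y y).
congr (op _ _); first exact: splice_prod_agree.
exact: splice_prod_agree.
Qed.

End Product.

Lemma good_cat n x y z w w' : good n x y w -> good n y z w' ->
  good n x z (w ++ w').
Proof.
move=> g g'; have [h1 h2 h3] := g; have [h1' h2' h3'] := g'; split.
- rewrite (splice_cat x w w' z y).
  apply (agree_trans (z2 := splice x w y)); last exact: h1.
  apply: splice_agree => //; by apply (agree_sub h1'); lia.
- apply (agree_trans (z2 := shl (size w') (splice y w' z))); last exact: h2'.
  have -> : shl (size (w ++ w')) (splice x (w ++ w') z) =
            shl (size w') (shl (size w) (splice x (w ++ w') z)).
    by rewrite shl_shl size_cat PoszD GRing.addrC.
  rewrite (shl_splice_cat x w w' z y).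
  apply (agree_shl (N := size w')).
  have := splice_agree (a := (- n%:Z)%R) (b := (size w')%:Z) (w := w')
    (y := z) (y' := z) h2 (fun i _ => erefl).
  by move=> h; apply (agree_sub h); lia.
- have := splice_prod_good andb (in_language (n := n)) g g'.
  by rewrite /admissible /splice_prod => ->; apply/andP.
Qed.

Lemma recognizable_prod (T : choiceType) (idx : T) (op : Monoid.law idx) n
    (lam : n.*2.+1.-tuple A -> T) x y v :
  finite_set [set: T] ->
  recognizable (fun w : word A => splice_prod op lam x w y = v).
Proof.
move=> finT; have [t h] := window_congruence (x 0%R) op finT lam.
by exists t => w w' /h[_ _ <-].
Qed.

Lemma recognizable_good n x y : recognizable (fun w : word A => good n x y w).
Proof.
have [t h] := window_congruence (x 0%R) andb (finite_finset (T := bool))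
  (in_language (n := n)).
exists t => w w' /h[h1 h2 h3] [g1 g2 g3]; split.
- apply (agree_trans (z2 := splice x w y)); last exact: g1.
  apply: splice_take => //; by right.
- apply (agree_trans (z2 := shl (size (letters w)) (splice x w y))); last exact: g2.
  apply: splice_take_rev => //; by right.
- by move: g3; rewrite /admissible -![wprod _ _ _ _]/(splice_prod _ _ _ _ _) h3.
Qed.

(** The profinite analogue of a path from [x] to [y] in the inverse limit of the
    Rauzy graphs. *)
Definition joins x y (k : free_profinite_semigroup A) :=
  forall n, eventually_approx k (fun w : word A => good n x y w).

Lemma joinsM x y z k l : joins x y k -> joins y z l -> joins x z (k * l).
Proof.
move=> jk jl n; apply: recognizable_evM (jk n) (jl n) _.
  exact: recognizable_good.
by move=> v v'; apply: good_cat.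
Qed.

End Good.

Section JoinsExists.
Variables (A : finType) (X : set (full_shift A)).
Implicit Types (x y z : full_shift A) (w : seq A).

Lemma center_block n z z' : agree (- n%:Z)%R n z z' <->
  block z (- n%:Z)%R n.*2 = block z' (- n%:Z)%R n.*2.
Proof.
have e : Posz n = (- n%:Z + n.*2%:Z)%R by lia.
by rewrite {2}e; exact: block_agree.
Qed.

Lemma splice_block_agree n x y z (N : nat) : agree (- n%:Z)%R n z x ->
  agree (- n%:Z)%R n (shl N z) y ->
  agree (- n%:Z)%R (N%:Z + n%:Z)%R (splice x (block z 0 N) y) z.
Proof.
move=> zx zy; rewrite -[in X in agree _ _ _ X](splice_block z N).
apply: splice_agree; rewrite ?size_tuple.
  by apply: agree_sym; apply (agree_sub zx); lia.
by apply: agree_sym; apply (agree_sub zy); lia.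
Qed.

(** A factor of a sequence, seen in contexts that agree with its own. *)
Lemma splice_prod_block (T : Type) (idx : T) (op : Monoid.law idx) n lam x y z (N : nat) :
  agree (- n%:Z)%R n z x -> agree (- n%:Z)%R n (shl N z) y ->
  splice_prod (n := n) op lam x (block z 0 N) y = wprod op lam z N.
Proof.
move=> zx zy; rewrite /splice_prod size_tuple; apply: wprod_agree.
exact: splice_block_agree.
Qed.

Hypothesis subX : subshift X.

Lemma admissible_shift n z N : X z -> admissible X n z N.
Proof. by move=> Xz; apply/admissibleP => i _; exists z, (i%:Z - n%:Z)%R. Qed.

Lemma good_block n x y z (N : nat) : X z -> agree (- n%:Z)%R n z x ->
  agree (- n%:Z)%R n (shl N z) y -> good X n x y (block z 0 N).
Proof.
move=> Xz zx zy; have zz := splice_block_agree zx zy; split.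
- apply (agree_trans (z2 := z)); last by apply (agree_sub zx); lia.
  by apply (agree_sub zz); lia.
- apply (agree_trans (z2 := shl N z)); last by apply (agree_sub zy); lia.
  by rewrite size_tuple; apply (agree_shl (N := N)); apply (agree_sub zz); lia.
- have := admissible_shift n N Xz.
  by rewrite /admissible -(splice_prod_block andb (in_language X (n := n)) zx zy).
Qed.

Lemma joins_cluster x y (w : nat -> word A) :
  (forall n, good X n x y (w n)) ->
  exists2 k, joins X x y k & forall Q, eventually_approx k Q ->
    forall M, exists2 n, (M <= n)%N & eventually_approx (completion_eta (w n)) Q.
Proof.
move=> gw; have [k kP] := cluster_ev (fun n => completion_eta (w n)).
exists k => // n; apply: (recognizable_cluster (M := n) kP).
  exact: recognizable_good.
move=> m nm; apply: ev_eta_recognizable; first exact: recognizable_good.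
exact: good_le (gw m).
Qed.

End JoinsExists.

(** Every central block of [y] occurs to the right of the origin of [x], whence
    good words from [x] to [y] at every level; take a cluster point. *)
Lemma joins_exists (A : finType) (X : set (full_shift A)) x y :
  minimal_subshift X -> X x -> X y -> exists k, joins X x y k.
Proof.
move=> minX Xx Xy; have [subX _] := minX.
have h n : {w : word A | good X n x y w}.
  apply: cid.
  have Ly : language_of_length X n.*2 (block y (- n%:Z)%R n.*2).
    by exists y, (- n%:Z)%R.
  have [N rec] := uniform_recurrence minX Ly.
  have [i _ e] := rec _ (subshift_shl subX 1 Xx).
  pose c := (i + n).+1.
  have g : good X n x y (block x 0 c).
    apply: good_block => //; apply/center_block; rewrite -e !block_shl.
    by apply: eq_block; rewrite /c; lia.
  have ne : (block x 0 c : seq A) != [::] by rewrite -size_eq0 size_tuple.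
  by exists (Word ne).
have [k kP _] := joins_cluster (fun n => projT2 (h n)).
by exists k.
Qed.

(** * Units of local monoids of a profinite semigroup *)

Section Powers.
Variable S : semigroupType.
Implicit Types a b e : S.

(** This is the power of exponent [i + 1], a semigroup having no unit. *)
Definition spow a i := iter i (fun b => a * b) a.

Lemma spow_add a i j : spow a i * spow a j = spow a (i + j).+1.
Proof. by elim: i => [//|i IH]; rewrite addSn /= -mulgA IH. Qed.

Lemma spowSr a i : spow a i.+1 = spow a i * a.
Proof. by have := spow_add a i 0; rewrite addn0. Qed.

Lemma spow_period a e i q : a * e = a -> e * e = e -> spow a q = e ->
  spow a (i.+1 * q.+1).-1 = e.
Proof.
move=> ae ee aq; elim: i => [|i IH]; first by rewrite mul1n.
have -> : (i.+2 * q.+1).-1 = (q + (i.+1 * q.+1).-1).+1 by lia.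
by rewrite -spow_add aq IH.
Qed.

Lemma repeated_value (T : finType) (f : nat -> T) : exists i j, (i < j)%N /\ f i = f j.
Proof.
have /injectivePn[i [j ij e]] : ~~ injectiveb (fun i : 'I_#|T|.+1 => f i).
  by apply/negP => /injectiveP /leq_card; rewrite card_ord ltnn.
have [|lt|/val_inj ji] := ltngtP i j; first by exists i, j.
  by exists j, i.
by rewrite ji eqxx in ij.
Qed.

(** Two powers of [a] coincide, and cancelling the smaller one with the
    right inverse leaves a power equal to [e]. *)
Lemma finite_right_invertible a b e :
  finite_set [set: S] -> e * e = e -> e * a = a -> a * e = a ->
  a * b = e -> exists q, spow a q = e.
Proof.
move=> /finite_code[N [c ci]] ee ea ae ab.
pose d := e * b * e; have ad : a * d = e by rewrite /d !mulgA ae ab.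
have ed : e * d = d by rewrite /d !mulgA ee.
have eds i : e * spow d i = spow d i by case: i => [|i] //=; rewrite mulgA ed.
have aes i : spow a i * e = spow a i.
  by case: i => [|i] //; rewrite spowSr -mulgA ae.
have pows i : spow a i * spow d i = e.
  elim: i => [//|i IH]; rewrite spowSr [spow d i.+1]/=.
  by rewrite -mulgA [a * _]mulgA ad eds.
have [i [j [ij /ci aij]]] := repeated_value (fun i => c (spow a i)).
exists (j - i.+1)%N; rewrite -aes -{1}(pows i) mulgA spow_add.
by have -> : (j - i.+1 + i).+1 = j; [lia|rewrite -aij].
Qed.

End Powers.

Section Units.
Variables (S : semigroupType) (H : set (semigroup_completion S)).
Variable e : semigroup_completion S.
Hypotheses (maxH : maximal_subgroup H) (He : H e) (ee : e * e = e).
Implicit Types (h k s : semigroup_completion S).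

Lemma subgroup_identity h : H h -> e * h = h /\ h * e = h.
Proof.
case: maxH => -[_ [e' [He' H1 HV]]] _ Hh.
have -> : e = e'; last by have [-> ->] := H1 _ Hh.
have [f [Hf ef fe]] := HV e He.
by rewrite -ef -{2}ee -mulgA ef; have [_ ->] := H1 _ He.
Qed.

Let units := [set h | [/\ e * h = h, h * e = h & exists h',
  [/\ e * h' = h', h' * e = h', h * h' = e & h' * h = e]]].

(** The units of the local monoid at [e] form a subgroup that contains [H]. *)
Let H_units : H = units.
Proof.
case: maxH => -[HM [e' [He' H1 HV]]] maxl; apply/esym/maxl.
  split.
    move=> h k [eh he [h' [eh' h'e hh' h'h]]] [ek ke [k' [ek' k'e kk' k'k]]].
    split; rewrite ?mulgA ?eh // -?mulgA ?ke //.
    exists (k' * h'); split; rewrite ?mulgA ?ek' // -?mulgA ?h'e //.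
      by rewrite [k * _]mulgA kk' eh'.
    by rewrite [h' * _]mulgA h'h ek.
  exists e; split=> [|h [] //|h [eh he [h' [eh' h'e hh' h'h]]]].
    by split => //; exists e.
  by exists h'; split => //; split => //; exists h.
move=> h Hh; have [eh he] := subgroup_identity Hh; split => //.
have ee' : e = e'.
  have [f [Hf ef fe]] := HV e He.
  by rewrite -ef -{2}ee -mulgA ef; have [_ ->] := H1 _ He.
have [h' [Hh' hh' h'h]] := HV h Hh; exists h'; rewrite ee'.
by have [? ?] := H1 _ Hh'; split.
Qed.

(** A right-invertible element of a finite monoid is invertible and its inverse
    is a power of it; the inverses in the finite quotients come together as a
    cluster point of the powers. *)
Lemma locally_right_invertible s : e * s = s -> s * e = s ->
  (forall t : finite_congruence S, exists d, at_ t (s * d) = at_ t e) -> H s.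
Proof.
move=> es se inv; rewrite H_units; split => //.
have at_spow t i : at_ t (spow s i) = spow (at_ t s) i.
  by elim: i => [//|i IH]; rewrite /= at_mul IH.
have pw t : exists q, at_ t (spow s q) = at_ t e.
  have [d sd] := inv t; have fin := cong_finite t.
  have [q e'] := @finite_right_invertible (quot t) (at_ t s) (at_ t d) (at_ t e) fin
    (congr1 (at_ t) ee) (congr1 (at_ t) es) (congr1 (at_ t) se) sd.
  by exists q; rewrite at_spow.
(* The exponent is 2 n! - 1: eventually s ^ n! is e in each finite quotient, and
   the factor 2 keeps the exponent positive. *)
have [l lP] := cluster_point (fun n => spow s ((2 * n`!).-2)).
have sl : s * l = e /\ l * s = e.
  have fact_pow t n q : at_ t (spow s q) = at_ t e -> (q < n)%N ->
      at_ t (spow s (2 * n`!).-1) = at_ t e.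
    move=> sq qn; have /dvdnP[i iq] : (q.+1 %| 2 * n`!)%N.
      by apply/dvdn_mull/dvdn_fact; lia.
    have : (0 < 2 * n`!)%N by rewrite muln_gt0 fact_gt0.
    rewrite iq; case: i {iq} => // i _; rewrite at_spow.
    apply: spow_period; first exact: (congr1 (at_ t) se).
      exact: (congr1 (at_ t) ee).
    by rewrite -at_spow.
  have fact_pred n : (2 * n`!).-1 = (2 * n`!).-2.+1.
    by have := fact_gt0 n; lia.
  split; apply: completionP => t; have [q sq] := pw t.
    have [n qn e'] := lP t q.+1.
    by rewrite at_mul -e' -(fact_pow t n q) // fact_pred.
  have [n qn e'] := lP t q.+1.
  rewrite at_mul -e' -(fact_pow t n q) // fact_pred.
  by rewrite spowSr.
case: sl => sl ls; exists (e * l * e).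
by split; rewrite ?mulgA ?ee // -?mulgA ?ee // ?es ?ls // !mulgA se sl.
Qed.

End Units.

(** * The language of a minimal subshift in a finite quotient *)

(** The congruence is extended to the free monoid, the empty word becoming an
    adjoined unit, so that prefixes and suffixes may be empty. *)
Lemma congruence_evaluation (A : finType) (t : finite_congruence (word A)) :
  exists (T : finType) (ev : seq A -> T),
  (forall u u' v v', ev u = ev u' -> ev v = ev v' -> ev (u ++ v) = ev (u' ++ v')) /\
  (forall w w' : word A, t w w' <-> ev w = ev w').
Proof.
have [N [c cP]] := congruence_code t.
pose ev (u : seq A) := omap c (insub u : option (word A)).
have evw (w : word A) : ev w = Some (c w) by rewrite /ev valK.
have ev0 : ev [::] = None by rewrite /ev insubF.
exists (option 'I_N), ev; split=> [u u' v v'|w w']; last first.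
  by rewrite !evw; split=> [/cP ->|[/cP]].
have seqP (s : seq A) : s = [::] \/ exists w : word A, s = letters w.
  by case: s => [|a s]; [left|right; exists (Word (isT : a :: s != [::]))].
have catE (w w' : word A) : letters w ++ letters w' = letters (w * w') by [].
have [->|[w ->]] := seqP u; have [->|[w' ->]] := seqP u';
  have [->|[q ->]] := seqP v; have [->|[q' ->]] := seqP v';
  rewrite ?catE ?cats0 ?cat0s ?ev0 ?evw //.
move=> [/cP ww'] [/cP qq']; congr Some; apply/cP; exact: congM.
Qed.

Section Stability.
Variables (A : finType) (T : finType) (ev : seq A -> T).
Hypothesis evM : forall u u' v v',
  ev u = ev u' -> ev v = ev v' -> ev (u ++ v) = ev (u' ++ v').
Implicit Types u v p q b : seq A.

Let evMl p u v : ev u = ev v -> ev (p ++ u) = ev (p ++ v).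
Proof. by move=> e; apply: evM. Qed.

Let evMr q u v : ev u = ev v -> ev (u ++ q) = ev (v ++ q).
Proof. by move=> e; apply: evM. Qed.

Let wpow b i := flatten (nseq i b).

Let wpowD b i j : wpow b (i + j) = wpow b i ++ wpow b j.
Proof. by rewrite /wpow nseqD flatten_cat. Qed.

Let ev_wpow p u b i : ev u = ev (p ++ u ++ b) -> ev u = ev (wpow p i ++ u ++ wpow b i).
Proof.
move=> e; elim: i => [|i IH]; first by rewrite /= cats0.
have -> : wpow b i.+1 = b ++ wpow b i by [].
have -> : wpow p i.+1 = wpow p i ++ p by rewrite -addn1 wpowD /wpow /= cats0.
rewrite {1}IH -!catA; apply: evMl; rewrite {1}(evMr (wpow b i) e).
by rewrite -!catA.
Qed.

(** Stability of finite semigroups: iterating the relation [u = p u b] until two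
    powers of [b] have the same value shows that [u] is a right multiple of
    [u b]. *)
Lemma ev_stable_right p u b : ev u = ev (p ++ u ++ b) ->
  exists c, ev (u ++ b ++ c) = ev u.
Proof.
move=> e; have [i [j [ij bij]]] := repeated_value (fun i => ev (wpow b i)).
exists (wpow b (j - i.+1)).
have -> : b ++ wpow b (j - i.+1) = wpow b (j - i).
  by have -> : (j - i = (j - i.+1).+1)%N by lia.
rewrite (evMr _ (ev_wpow i e)) -!catA -wpowD.
have -> : (i + (j - i) = j)%N by lia.
by rewrite [RHS](ev_wpow i e); do 2 apply: evMl.
Qed.

Lemma ev_stable_left p u b : ev u = ev (p ++ u ++ b) ->
  exists c, ev (c ++ p ++ u) = ev u.
Proof.
move=> e; have [i [j [ij bij]]] := repeated_value (fun i => ev (wpow p i)).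
exists (wpow p (j - i.+1)).
have -> : wpow p (j - i.+1) ++ p ++ u = wpow p (j - i) ++ u.
  have -> : (j - i = (j - i.+1) + 1)%N by lia.
  by rewrite wpowD -catA {3}/wpow /= cats0.
rewrite (evMl _ (ev_wpow i e)) catA -wpowD.
have -> : (j - i + i = j)%N by lia.
by rewrite [RHS](ev_wpow i e); apply: evMr.
Qed.

(** Green's relation R. *)
Definition Rrel u v := (exists c, ev (u ++ c) = ev v) /\ (exists c, ev (v ++ c) = ev u).

Lemma Rrel_refl u : Rrel u u.
Proof. by split; exists [::]; rewrite cats0. Qed.

Lemma Rrel_sym u v : Rrel u v -> Rrel v u.
Proof. by case. Qed.

Lemma Rrel_trans u v q : Rrel u v -> Rrel v q -> Rrel u q.
Proof.
move=> [[c uc] [d vd]] [[c' vc'] [d' qd']]; split.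
  by exists (c ++ c'); rewrite catA (evMr c' uc).
by exists (d' ++ d); rewrite catA (evMr d qd').
Qed.

Lemma Rrel_cat p u v : Rrel u v -> Rrel (p ++ u) (p ++ v).
Proof.
move=> [[c uc] [d vd]].
by split; [exists c|exists d]; rewrite -catA; apply: evMl.
Qed.

Variable X : set (full_shift A).
Hypothesis minX : minimal_subshift X.
Implicit Types (x y z : full_shift A).

Let subX : subshift X. Proof. by case: minX. Qed.

Let multiples u : {set T} :=
  finset (fun s => `[< exists p q, s = ev (p ++ u ++ q) >]).

Let multiples_sub p u q : multiples (p ++ u ++ q) \subset multiples u.
Proof.
apply/fintype.subsetP => s; rewrite !finset.inE => /asboolP[p' [q' ->]].
by apply/asboolP; exists (p' ++ p), (q ++ q'); rewrite -!catA.
Qed.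

(** All long words of the language generate the same ideal: by uniform
    recurrence each of them has as a factor a word whose ideal is smallest. *)
Lemma long_words_factor : exists N, forall z z' i j n m,
  X z -> X z' -> (N <= n)%N -> (N <= m)%N ->
  exists p q, ev (block z i n) = ev (p ++ block z' j m ++ q).
Proof.
pose P c := `[< exists z n, X z /\ #|multiples (block z 0 n)| = c >].
have exP : exists c, P c.
  have [[z Xz] _ _] := subX.
  by exists #|multiples (block z 0 0)|; apply/asboolP; exists z, 0.
have [_ /asboolP[z0 [n0 [Xz0 <-]]] minc] := ex_minnP exP.
have [|N rec] := uniform_recurrence (n := n0) minX (u := block z0 0 n0).
  by exists z0, 0%R.
have multE z i n : X z -> (N + n0 <= n)%N ->
    multiples (block z i n) = multiples (block z0 0 n0).
  move=> Xz Nn; have [k kN e] := rec _ (subshift_shl subX i Xz).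
  apply/eqP; rewrite eqEcard; apply/andP; split.
    have -> : n = (k + (n0 + (n - n0 - k)))%N by lia.
    rewrite !block_cat.
    have -> : block z (i + k%:Z)%R n0 = block z0 0 n0.
      by rewrite -e block_shl; apply: eq_block; lia.
    exact: multiples_sub.
  apply: minc; apply/asboolP; exists (shl i z), n; split; first exact: subshift_shl.
  by rewrite block_shl; congr #|multiples (block _ _ _)|; lia.
exists (N + n0)%N => z z' i j n m Xz Xz' Nn Nm.
have : ev (block z i n) \in multiples (block z i n).
  by rewrite finset.inE; apply/asboolP; exists [::], [::]; rewrite cats0.
by rewrite multE // -(multE z' j m) // finset.inE => /asboolP.
Qed.

(** Along an edge of a Rauzy graph of large order, left translation by the middle
    letter [a] maps the R-class of the right half [v'] of the target into that of
    the right half [v] of the source, since [a v'] is R-equivalent to its prefix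
    [v] by stability. It is injective because, again by stability, some [b]
    satisfies [b a v' = v'], and this passes to the right multiples of [v']. *)
Lemma letter_action : exists N, forall n z (a : A), (N <= n)%N -> a = z 0%R ->
  language_of_length X n.*2.+1 (block z (- n%:Z)%R n.*2.+1) ->
  (forall u, Rrel u (block (shl 1 z) 0 n) -> Rrel (a :: u) (block z 0 n)) /\
  (exists b, forall u, Rrel u (block (shl 1 z) 0 n) -> ev (b ++ a :: u) = ev u).
Proof.
have [N fac] := long_words_factor; exists N => n z a Nn az.
move=> /(language_recenter subX (- n%:Z)%R)[z' Xz' /block_agree zz'].
set v := block z 0 n; set v' := block (shl 1 z) 0 n.
have ve : v = block z' 0 n :> seq A.
  by congr val; apply/block_agree; apply (agree_sub zz'); lia.
have v'e : v' = block z' 1 n :> seq A.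
  congr val; rewrite /v' block_shl.
  by apply/block_agree; apply (agree_sub zz'); lia.
(* The word a v' = v z'_n of length n + 1, in its two factorizations. *)
have av'e : a :: v' = block z' 0 n.+1 :> seq A.
  rewrite -add1n block_cat v'e -cat1s; congr cat.
  apply: (@eq_from_nth _ a); rewrite ?size_tuple // => -[|//] _.
  by rewrite nth_block // az zz'; [congr z'|]; lia.
have av'r : a :: v' = v ++ [:: z' (Posz n)] :> seq A.
  rewrite av'e -addn1 block_cat ve; congr cat.
  apply: (@eq_from_nth _ a); rewrite ?size_tuple // => -[|//] _.
  by rewrite nth_block //; congr z'; lia.
have Rav : Rrel (a :: v') v.
  split; last by exists [:: z' (Posz n)]; rewrite av'r.
  have [p [q]] := fac z' z' 0 0 n n.+1 Xz' Xz' Nn (leq_trans Nn (leqnSn n)).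
  rewrite -ve -av'e av'r -catA => /ev_stable_right[c].
  by exists (q ++ c); rewrite -catA.
split=> [u uv'|].
  by apply: Rrel_trans Rav; apply: (Rrel_cat [:: a]).
have [p [q]] := fac z' z' 1%R 0%R n n.+1 Xz' Xz' Nn (leq_trans Nn (leqnSn n)).
rewrite -v'e -av'e -[a :: v']/([:: a] ++ tval v') -catA catA => /ev_stable_left[c bv'].
exists (c ++ p) => u [_ [d v'd]].
have -> : (c ++ p) ++ a :: u = (c ++ (p ++ [:: a])) ++ u by rewrite -!catA.
rewrite -(evMl _ v'd) catA -v'd; apply: evMr.
by rewrite -[RHS]bv' !catA.
Qed.

End Stability.

Section GoodAction.
Variables (A : finType) (T : finType) (ev : seq A -> T).
Hypothesis evM : forall u u' v v',
  ev u = ev u' -> ev v = ev v' -> ev (u ++ v) = ev (u' ++ v').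
Variable X : set (full_shift A).
Hypothesis minX : minimal_subshift X.
Implicit Types (x y z : full_shift A) (u v w : seq A).

Lemma splice_letters x w y : w = block (splice x w y) 0 (size w).
Proof.
apply: (@eq_from_nth _ (x 0%R)); rewrite ?size_tuple // => k kw.
by rewrite nth_block // GRing.add0r splice_prefix.
Qed.

Lemma block_shl_splice n x w y : block (shl (size w) (splice x w y)) 0 n = block y 0 n.
Proof.
have -> : shl (size w) (splice x w y) = splice (shl (size w) (splice x w y)) [::] y.
  by rewrite -shl_splice_cat cats0.
by apply/block_agree => -[k|//] _ /=; rewrite subn0.
Qed.

Lemma admissible_action : exists N, forall n z M, (N <= n)%N -> admissible X n z M ->
  forall u, Rrel ev u (block (shl M z) 0 n) -> Rrel ev (block z 0 M ++ u) (block z 0 n).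
Proof.
have [N act] := letter_action evM minX; exists N => n z M Nn.
elim: M z => [|M IH] z adm u uz.
  have -> : block z 0 0 = [::] :> seq A by apply: size0nil; rewrite size_tuple.
  by rewrite shl0 in uz.
move: adm; rewrite /admissible /= => /andP[/set_mem Lz adm].
have [fw _] := act n z (z 0%R) Nn erefl Lz.
have -> : block z 0 M.+1 = z 0%R :: block (shl 1 z) 0 M :> seq A.
  rewrite -add1n block_cat -cat1s; congr cat.
    apply: (@eq_from_nth _ (z 0%R)); rewrite ?size_tuple // => -[|//] _.
    by rewrite nth_block.
  by congr val; rewrite block_shl.
apply: fw; apply: IH => //.
by rewrite shl_shl; have -> : (Posz M + 1)%R = Posz M.+1 by lia.
Qed.

Lemma good_action : exists N, forall n x y w, (N <= n)%N -> good X n x y w ->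
  forall u, Rrel ev u (block y 0 n) -> Rrel ev (w ++ u) (block x 0 n).
Proof.
have [N act] := admissible_action; exists N => n x y w Nn [g1 _ g3] u.
rewrite -(block_shl_splice n x w y) => uy.
have := act _ _ _ Nn g3 u uy; rewrite -splice_letters.
have -> // : block (splice x w y) 0 n = block x 0 n.
by apply/block_agree; apply (agree_sub g1); lia.
Qed.

Lemma good_flatten n x w m : good X n x x w ->
  good X n x x (flatten (nseq m.+1 w)).
Proof.
move=> g; elim: m => [|m IH]; first by rewrite /= cats0.
exact: good_cat IH.
Qed.

Lemma good_take n x y w : good X n x y w -> (n <= size w)%N ->
  take n w = block x 0 n.
Proof.
move=> [g1 _ _] nw; apply: (@eq_from_nth _ (x 0%R)).
  by rewrite size_takel // size_tuple.
move=> k; rewrite size_takel // => kn; rewrite nth_take // nth_block //.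
rewrite GRing.add0r; have <- : splice x w y k = x k by apply: g1; lia.
by rewrite splice_prefix //; apply: leq_trans nw.
Qed.

(** [w] has the same value as its powers, and a long power begins with the right
    half of [x]; conversely [w] acts on the R-class of that right half. *)
Lemma idempotent_Rrel : exists N, forall n x w, (N <= n)%N -> w != [::] ->
  good X n x x w -> ev (w ++ w) = ev w -> Rrel ev w (block x 0 n).
Proof.
have [N act] := good_action; exists N => n x w Nn w0 g ww; split.
  have [[c wc] _] := act n x x w Nn g _ (Rrel_refl ev _).
  by exists (block x 0 n ++ c); rewrite catA.
pose W := flatten (nseq n.+1 w).
have evW : ev W = ev w.
  rewrite /W; elim: (n) => [|m IH]; first by rewrite /= cats0.
  by rewrite -[RHS]ww; apply: evM.
have sW : (n <= size W)%N.
  rewrite size_flatten /shape map_nseq sumn_nseq.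
  by rewrite -size_eq0 in w0; case: (size w) w0 => // s _; rewrite mulSn; lia.
exists (drop n W); rewrite -evW -(good_take (good_flatten n g) sW).
by rewrite cat_take_drop.
Qed.

End GoodAction.

Lemma word_neq (A : choiceType) (w : word A) : letters w != [::].
Proof. by case: w. Qed.

Section JoinsFinite.
Variables (A : finType) (X : set (full_shift A)).
Hypothesis minX : minimal_subshift X.
Implicit Types (x y z : full_shift A) (e r : free_profinite_semigroup A).

(** In a finite quotient, left translation by [e] and by [r] preserves the R-class
    of the value of a long right half of [y]; the value of [e] lies in this class,
    hence so does that of [e r e]. *)
Lemma joins_right_invertible y e r (t : finite_congruence (word A)) :
  joins X y y e -> e * e = e -> joins X y y r ->
  exists d, at_ t (e * r * e * d) = at_ t e.
Proof.
move=> je ee jr; have [T [ev [evM evP]]] := congruence_evaluation t.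
have [N1 act] := good_action evM minX.
have [N2 idem] := idempotent_Rrel evM minX.
pose n := (N1 + N2)%N.
have [w gw ew] := ev_exists t (je n).
have [v gv rv] := ev_exists t (jr n).
have ww : ev (w ++ w) = ev w.
  apply/(evP (w * w) w); have := (approx_cong w (approxM ew ew)).1.
  by rewrite ee; apply.
have wv : Rrel ev w (block y 0 n).
  apply: idem => //; [by rewrite /n; lia|exact: word_neq].
have N1n : (N1 <= n)%N by rewrite /n; lia.
have [[c wc] _] := Rrel_trans evM (act n y y w N1n gw _ (act n y y v N1n gv _ wv))
  (Rrel_sym wv).
have ne : c ++ letters w != [::] by case: (c) => //=; exact: word_neq.
exists (completion_eta (Word ne)).
have h : approx t (e * r * e * completion_eta (Word ne)) (w * v * w * Word ne).
  by do !apply: approxM.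
rewrite (h : at_ t _ = _) ew; apply/quot_piE/evP.
have -> : letters (w * v * w * Word ne) = ((w ++ v ++ w) ++ c) ++ w by rewrite /= -!catA.
by rewrite -ww; apply: evM.
Qed.

End JoinsFinite.

(** * The bi-infinite word of a maximal subgroup *)

Section SubgroupPoint.
Variables (A : finType) (X : set (full_shift A)).
Hypothesis subX : subshift X.
Implicit Types (x y z : full_shift A) (w : seq A).

Definition starts n w y := take n w = block y 0 n.
Definition ends n w y := take n (rev w) = mkseq (fun k => y (Negz k)) n.

Lemma starts_agree n w y x z : starts n w y -> agree 0 n (splice x w z) y.
Proof.
move=> sw; have nw : (n <= size w)%N.
  by have := congr1 size sw; rewrite size_tuple size_take; case: ltnP; lia.
move=> [k|k] kn; last lia.
rewrite splice_prefix; last lia.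
have kn' : (k < n)%N by lia.
by rewrite -(nth_take _ kn') sw nth_block // GRing.add0r.
Qed.

Lemma ends_agree n w y x z : ends n w y ->
  agree (- n%:Z)%R 0 (shl (size w) (splice x w z)) y.
Proof.
move=> ew; have nw : (n <= size w)%N.
  have := congr1 size ew.
  by rewrite size_mkseq size_take size_rev; case: ltnP; lia.
move=> [k|k] kn; first lia.
have kn' : (k < n)%N by lia.
rewrite splice_suffix; last exact: leq_trans nw.
by rewrite -[LHS](nth_take _ kn') ew nth_mkseq.
Qed.


Variable a0 : A.

Lemma ends_congruence n : exists t : finite_congruence (word A),
  forall w w' : word A, t w w' ->
  [/\ take n w = take n w', take n (rev w) = take n (rev w') &
      forall x y, admissible X n (splice x w y) (size w) =
                  admissible X n (splice x w' y) (size w')].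
Proof.
exact: (window_congruence a0 andb (finite_finset (T := bool)) (in_language X (n := n))).
Qed.

(** An idempotent is its own power of exponent [n + 1], so it is congruent to words
    of length greater than [n], and the congruence sees prefixes of length [n]. *)
Lemma idempotent_size n (e : free_profinite_semigroup A)
    (t : finite_congruence (word A)) (w : word A) :
  (forall w w' : word A, t w w' -> take n w = take n w') ->
  e * e = e -> approx t e w -> (n <= size (letters w))%N.
Proof.
move=> tn ee ew; have es i : spow e i = e by elim: i => //= i ->.
have ws i : approx t (spow e i) (spow w i).
  by elim: i => //= i IH; apply: approxM.
have ss i : (i < size (letters (spow w i)))%N.
  elim: i => [|i IH] /=; first by rewrite lt0n size_eq0 word_neq.
  by rewrite size_cat -addn1 addnC leq_add // lt0n size_eq0 word_neq.
have := tn _ _ ((approx_cong _ (ws n)).1 _); rewrite es => /(_ _ ew) /(congr1 size).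
by rewrite size_takel ?(ltnW (ss n)) // size_take; case: ltnP; lia.
Qed.

(** The right half of the point is read on the prefixes of the idempotent, and
    the left half on its suffixes. An element [h] of [H] is congruent to a word of
    the language and, as [h = e h e], this word may be surrounded by words
    congruent to [e], which provide the halves of [y] as contexts. *)
Lemma subgroup_point (H : set (free_profinite_semigroup A)) e :
  H e -> e * e = e -> (forall h, H h -> e * h = h /\ h * e = h) ->
  H `<=` language_closure X ->
  exists2 y, X y & forall h, H h -> joins X y y h.
Proof.
move=> He ee eH HL.
have tP0 n := cid (ends_congruence n).
pose t n : finite_congruence (word A) := projT1 (tP0 n).
have tP n : forall w w' : word A, t n w w' ->
  [/\ take n w = take n w', take n (rev w) = take n (rev w') &
      forall x y, admissible X n (splice x w y) (size w) =
                  admissible X n (splice x w' y) (size w')].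
  by rewrite /t; case: (tP0 n).
pose p n : word A := repr (at_ (t n) e).
have pe n : approx (t n) e (p n) by apply: approx_repr.
have size_e n (w : word A) : approx (t n) e w -> (n <= size (letters w))%N.
  by apply: idempotent_size => // v v' /tP[].
pose y : full_shift A := fun i => match i with
  | Posz k => nth a0 (p k.+1) k | Negz k => nth a0 (rev (p k.+1)) k end.
have se n (w : word A) : approx (t n) e w -> starts n w y /\ ends n w y.
  move=> ew; have nw := size_e _ _ ew.
  have common k : (k < n)%N -> take k.+1 w = take k.+1 (p k.+1) /\
      take k.+1 (rev w) = take k.+1 (rev (p k.+1)).
    move=> kn; have [v ev ev'] := ev_exists (t n) (ev_approx (t k.+1) e).
    have [h1 h2 _] := tP _ _ _ ((approx_cong _ ew).1 ev').
    have [h1' h2' _] := tP _ _ _ ((approx_cong _ (pe k.+1)).1 ev).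
    split; [rewrite h1'|rewrite h2'].
      by have := congr1 (take k.+1) h1; rewrite !take_takel.
    by have := congr1 (take k.+1) h2; rewrite !take_takel.
  split; apply: (@eq_from_nth _ a0).
  - by rewrite size_takel // size_tuple.
  - move=> k; rewrite size_takel // => kn; rewrite nth_take // nth_block // GRing.add0r.
    by rewrite /= -[RHS](nth_take _ (ltnSn k)) -(common k kn).1 nth_take.
  - by rewrite size_takel ?size_rev // size_mkseq.
  - move=> k; rewrite size_takel ?size_rev // => kn; rewrite nth_take // nth_mkseq //.
    by rewrite /= -[RHS](nth_take _ (ltnSn k)) -(common k kn).2 nth_take.
(* A word of the language is admissible in the context where it occurs. *)
have lang_adm n (v : word A) : language X v ->
    exists x x', admissible X n (splice x v x') (size v).
  move=> [z [i [Xz vz]]]; exists (shl i z), (shl (size v) (shl i z)).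
  have -> : splice (shl i z) v (shl (size v) (shl i z)) = shl i z.
    have {1}-> : letters v = block (shl i z) 0 (size v).
      by rewrite {1}vz block_shl GRing.add0r.
    exact: splice_block.
  by apply: admissible_shift => //; exact: subshift_shl.
exists y.
  have [_ cX _] := subX; apply: (closed_agree cX) => M.
  have [w Lw ew] := closure_approx (t M) (HL _ He).
  have [x [x' adm]] := lang_adm M _ Lw.
  have [sw enw] := se _ _ ew; have wM := size_e _ _ ew.
  have eww : t M w (w * w).
    by apply/(approx_cong _ ew); rewrite -ee; apply: approxM.
  have [_ _ /(_ x x')] := tP _ _ _ eww.
  rewrite adm => /esym/admissibleP/(_ (size w)).
  have w0 : (0 < size (letters w))%N by rewrite lt0n size_eq0 word_neq.
  rewrite size_cat -[X in (X < _)%N]addn0 ltn_add2l => /(_ w0).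
  set z := splice x _ x' => Lz.
  have [z' Xz' e'] := language_recenter subX (- M%:Z)%R Lz.
  exists z' => // i iM.
  have -> : z' i = shl (size w) z i.
    apply/esym.
    have e2 : block (shl (size w) z) (- M%:Z)%R M.*2.+1 = block z' (- M%:Z)%R M.*2.+1.
      by rewrite block_shl -e'; apply: eq_block; lia.
    by move/block_agree: e2; apply; lia.
  have [i0|i0] : (i < 0)%R \/ (0 <= i)%R by lia.
    rewrite /z (splice_cat x w w x' x); apply: (ends_agree _ _ enw); lia.
  rewrite /z (shl_splice_cat x w w x' x); apply: (starts_agree _ _ sw); lia.
move=> h Hh n; have [eh he] := eH _ Hh.
apply: recognizable_ev; first exact: recognizable_good.
move=> tt; have [t' tle] := congruence_meet (t n) tt.
have [v Lv hv'] := closure_approx t' (HL _ Hh).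
have hv : approx (t n) h v by apply: approx_coarser hv' => a b /tle[].
exists v; last by apply: approx_coarser hv' => a b /tle[].
have [x [x' adm]] := lang_adm n _ Lv.
have [sp ep] := se _ _ (pe n); have np := size_e _ _ (pe n).
have sv : starts n v y.
  have := (approx_cong v (approxM (pe n) hv)).1; rewrite eh => /(_ hv) /tP[+ _ _].
  by rewrite /starts => <-; rewrite /= takel_cat.
have ev : ends n v y.
  have := (approx_cong v (approxM hv (pe n))).1; rewrite he => /(_ hv) /tP[_ + _].
  by rewrite /ends => <-; rewrite /= rev_cat takel_cat ?size_rev.
split; [exact: starts_agree|exact: ends_agree|].
have := (approx_cong v (approxM (approxM (pe n) hv) (pe n))).1.
rewrite eh he => /(_ hv) /tP[_ _ /(_ x x')].
rewrite adm /= -catA /admissible.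
rewrite -[LHS]/(splice_prod andb (in_language X (n := n)) x (p n ++ v ++ p n) x').
rewrite (splice_prod_cat _ _ x (p n) (v ++ p n) x' x x) => /andP[_].
rewrite (splice_prod_cat _ _ _ v (p n) x' x x) => /andP[+ _].
congr is_true; apply: splice_prod_agree; first exact: ends_agree.
exact: starts_agree.
Qed.

End SubgroupPoint.

(** * Group labels and finite quotients of fundamental groupoids *)

Section Labels.
Variables (D : digraph) (G : groupType) (mu : edge D -> G).

Fixpoint walk_value (s : seq (sedge D)) : G :=
  if s is a :: s' then (if a.2 then (mu a.1)^-1 else mu a.1) * walk_value s' else 1.

Lemma walk_value_cat s1 s2 : walk_value (s1 ++ s2) = walk_value s1 * walk_value s2.
Proof. by elim: s1 => [|a s IH] /=; rewrite ?mul1g // IH mulgA. Qed.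

Lemma walk_value_eq u v (p q : walk u v) : walk_eq p q ->
  walk_value (steps p) = walk_value (steps q).
Proof.
elim=> {u v p q} //=.
- move=> [a b] u v p q /= -> ->; rewrite /= !mulg1.
  by case: b; rewrite /= ?mulVg ?mulgV.
- by move=> u v p q r _ -> _ ->.
- by move=> u v w p p' q q' _ pp' _ qq'; rewrite !walk_value_cat pp' qq'.
Qed.

Hypothesis finG : finite_set [set: G].

Let hom_value u v (f : fund_hom u v) : G := walk_value (steps (repr f)).

Let hom_value_pi u v (p : walk u v) : hom_value (fpi p) = walk_value (steps p).
Proof. exact/walk_value_eq/frepr. Qed.

Let label_rel u v : rel (fund_hom u v) := fun f g => hom_value f == hom_value g.

Let label_refl u v : reflexive (@label_rel u v).
Proof. by move=> f; apply: eqxx. Qed.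
Let label_sym u v : symmetric (@label_rel u v).
Proof. by move=> f g; apply: eq_sym. Qed.
Let label_trans u v : transitive (@label_rel u v).
Proof. by move=> g f h /eqP fg /eqP gh; rewrite /label_rel fg gh. Qed.

(** These quotients of the fundamental groupoid are enough to separate profinite
    words. *)
Lemma label_congruence : exists t : finite_gcongruence (fundamental_groupoid D),
  forall u v (p q : walk u v),
  gpi t (fpi p : @Defs.hom (fundamental_groupoid D) u v) = gpi t (fpi q) <->
  walk_value (steps p) = walk_value (steps q).
Proof.
pose r u v : equiv_rel (@Defs.hom (fundamental_groupoid D) u v) :=
  EquivRel (@label_rel u v) (@label_refl u v) (@label_sym u v) (@label_trans u v).
have rM u v w (f f' : @Defs.hom (fundamental_groupoid D) u v) g g' :
    r u v f f' -> r v w g g' -> r u w (gcomp f g) (gcomp f' g').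
  move=> /eqP ff' /eqP gg'; apply/eqP; rewrite /= !hom_value_pi /= !walk_value_cat.
  by rewrite -!/(hom_value _) ff' gg'.
have rfin u v : finite_set [set: {eq_quot (r u v)}].
  have [N [c ci]] := finite_code finG.
  apply: (@finite_setT_inj _ _ (fun a : {eq_quot (r u v)} => c (hom_value (repr a)))).
  move=> a b /ci ab; rewrite -[a]reprK -[b]reprK; apply/eqquotP.
  exact/eqP.
exists (FiniteGCongruence rM rfin) => u v p q; rewrite gpiE /= /label_rel !hom_value_pi.
by split=> [/eqP|->].
Qed.

End Labels.

Section GroupoidCalculus.
Variable Q : groupoid.

Lemma gcompK u v w (f : @Defs.hom Q u v) (g : @Defs.hom Q v w) :
  gcomp (gcomp f g) (ginv g) = f.
Proof. by rewrite -gcompA gcompVr gcomp1r. Qed.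

Lemma gcompKV u v w (f : @Defs.hom Q u v) (g : @Defs.hom Q w v) :
  gcomp (gcomp f (ginv g)) g = f.
Proof. by rewrite -gcompA gcompVl gcomp1r. Qed.

Lemma gcompI u v w (f : @Defs.hom Q u v) (g h : @Defs.hom Q v w) :
  gcomp f g = gcomp f h -> g = h.
Proof.
by move=> /(congr1 (gcomp (ginv f))); rewrite !gcompA !gcompVl !gcomp1l.
Qed.

Lemma gcompIr u v w (f g : @Defs.hom Q u v) (h : @Defs.hom Q v w) :
  gcomp f h = gcomp g h -> f = g.
Proof. by move=> /(congr1 (fun k => gcomp k (ginv h))); rewrite !gcompK. Qed.

Lemma ginv_unique u v (f : @Defs.hom Q u v) (g : @Defs.hom Q v u) :
  gcomp f g = gid u -> g = ginv f.
Proof. by move=> fg; apply: (gcompI (f := f)); rewrite fg gcompVr. Qed.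

End GroupoidCalculus.

Section CongruenceLabel.
Variables (D : digraph) (t : finite_gcongruence (fundamental_groupoid D)).
Variables (p0 : vertex D) (tree : forall u, walk p0 u).
Let Q := gquot t.
Let class u v (p : walk u v) : @Defs.hom Q u v := gpi t (fpi p).

Let class_cat u v w (p : walk u v) (q : walk v w) :
  class (walk_cat p q) = gcomp (class p) (class q).
Proof.
rewrite /class /= gquot_compE; congr gpi.
by rewrite -[RHS]/(fpi (walk_cat (repr (fpi p)) (repr (fpi q)))) fund_compE.
Qed.

Let class_rev u v (p : walk u v) : class (walk_rev p) = ginv (class p).
Proof.
rewrite /class /= gquot_invE; congr gpi.
by rewrite -[RHS]/(fpi (walk_rev (repr (fpi p)))) fund_invE.
Qed.

Lemma step_walk (a : sedge D) : is_walk (ssource a) [:: a] (starget a).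
Proof. by rewrite /= !eqxx. Qed.

(** Transport to the local group at the base vertex along a tree of paths. *)
Let label (e : edge D) : @local_group Q p0 :=
  gcomp (gcomp (class (tree (source e))) (class (Walk (step_walk (e, false)))))
    (ginv (class (tree (target e)))).

Let label_inv e : (label e)^-1 =
  gcomp (gcomp (class (tree (target e))) (class (Walk (step_walk (e, true)))))
    (ginv (class (tree (source e)))).
Proof.
apply/esym/ginv_unique; rewrite /label.
have -> : class (Walk (step_walk (e, true))) = ginv (class (Walk (step_walk (e, false)))).
  by rewrite -class_rev; congr class; apply: val_inj.
set a := class (tree (source e)); set b := class (tree (target e)).
set c := class (Walk _).
by rewrite !gcompA gcompKV gcompK gcompVr.
Qed.

Let label_walk u s v (sw : is_walk u s v) :
  walk_value label s = gcomp (gcomp (class (tree u)) (class (Walk sw)))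
    (ginv (class (tree v))).
Proof.
elim: s u sw => [|a s IH] u sw.
  have e : u = v by apply/eqP.
  case: v / e sw => sw.
  have -> : Walk sw = walk_nil u by apply: val_inj.
  have -> : class (walk_nil u) = @gid Q u by [].
  by rewrite gcomp1r gcompVr.
have /andP[/eqP ua sv] := sw; subst u; rewrite [walk_value _ _]/= (IH _ sv).
have -> : Walk sw = walk_cat (Walk (step_walk a)) (Walk sv) by apply: val_inj.
rewrite class_cat; case: a {sw} sv => e b sv.
set l := (if _ then _ else _).
have -> : l = gcomp (gcomp (class (tree (ssource (e, b))))
    (class (Walk (step_walk (e, b))))) (ginv (class (tree (starget (e, b))))).
  by rewrite /l {l sv}; case: b => //=; exact: label_inv.
have mE (f g : @local_group Q p0) : f * g = gcomp f g by [].
by rewrite mE !gcompA gcompKV.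
Qed.

(** A converse of [label_congruence] for connected graphs: group labels suffice
    to control all finite quotients of the fundamental groupoid, and unlike
    morphisms of groupoids they can be multiplied freely. *)
Lemma congruence_label : exists (G : groupType) (mu : edge D -> G),
  finite_set [set: G] /\
  forall u v (p q : walk u v),
    walk_value mu (steps p) = walk_value mu (steps q) ->
    gpi t (fpi p : @Defs.hom (fundamental_groupoid D) u v) = gpi t (fpi q).
Proof.
exists (@local_group Q p0 : groupType), label; split; first exact: gcong_finite.
move=> u v [p pw] [q qw] /=; rewrite (label_walk pw) (label_walk qw).
by move=> /gcompIr /gcompI.
Qed.

End CongruenceLabel.

(** * Classes of loops in the finite quotients *)

Section LoopClass.
Variables (D : digraph) (b : vertex D).
Implicit Types (t : finite_gcongruence (fundamental_groupoid D)) (s : seq (sedge D)).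

(** Loops are given by their sequences of steps, to avoid transporting walks
    between equal vertices. *)
Definition loop_class t (v : @Defs.hom (gquot t) b b) s :=
  exists sw : is_walk b s b,
    v = gpi t (fpi (Walk sw) : @Defs.hom (fundamental_groupoid D) b b).

Lemma loop_class_unique t v v' s : loop_class (t := t) v s -> loop_class v' s -> v = v'.
Proof.
move=> [sw ->] [sw' ->]; suff -> : Walk sw = Walk sw' by [].
exact: val_inj.
Qed.

Lemma loop_classM t v v' s s' : loop_class (t := t) v s -> loop_class v' s' ->
  loop_class (gcomp v v') (s ++ s').
Proof.
move=> [sw ->] [sw' ->]; exists (is_walk_cat sw sw'); rewrite /= gquot_compE.
congr gpi; rewrite -[LHS]/(fpi (walk_cat (repr (fpi (Walk sw))) (repr (fpi (Walk sw'))))).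
rewrite fund_compE; apply/fpiE/walk_eq_steps; exact: erefl.
Qed.

Lemma loop_class_coarser t t' v v' s :
  (forall u v f g, t u v f g -> t' u v f g) ->
  loop_class (t := t) v s -> loop_class (t := t') v' s -> gpi t' (repr v) = v'.
Proof.
move=> le [sw ->] [sw' ->]; have -> : Walk sw' = Walk sw by apply: val_inj.
by apply/gpiE/le/grepr.
Qed.

Lemma loop_class_repr t (v : @Defs.hom (gquot t) b b) : exists s, loop_class v s.
Proof.
exists (steps (repr (repr v : fund_hom b b))).
exists (valP (repr (repr v : fund_hom b b))).
rewrite -[LHS](gpiK v); congr gpi; rewrite -[LHS]fpiK; congr fpi.
by apply: val_inj.
Qed.

End LoopClass.

Lemma loop_class_map (D D' : digraph) (f : digraph_morphism D D') b b'
    (e : vmap f b = b') (c : pro_local (G := fundamental_groupoid D) b)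
    (t : finite_gcongruence (fundamental_groupoid D')) s :
  loop_class (val c (pullback (fundamental_functor f) t)) s ->
  loop_class (val (pro_local_map (F := fundamental_functor f) e c) t) (map (smap f) s).
Proof.
case: b' / e => -[sw vs]; exists (is_walk_map f sw).
rewrite /pro_local_map /= vs.
transitivity (gpi t (fhom (fundamental_functor f)
    (fpi (Walk sw) : @Defs.hom (fundamental_groupoid D) b b))).
  apply/gpiE; exact: (grepr (pullback (fundamental_functor f) t)).
congr gpi; apply/fpiE; apply: (walk_eq_trans (q := walk_map f (Walk sw))).
  exact/walk_map_eq/frepr.
exact: walk_eq_steps.
Qed.

(** * Walks labelled by good words *)

Section RauzyWalks.
Variables (A : finType) (X : set (full_shift A)).
Implicit Types (x y z : full_shift A) (w : seq A).

Definition window_step n (u : n.*2.+1.-tuple A) : seq (sedge (rauzy X n.*2)) :=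
  if insub u is Some e then [:: (e, false)] else [::].

Lemma window_stepE n (u : n.*2.+1.-tuple A) (Lu : in_language X u) :
  window_step u = [:: (to_set_type Lu : edge (rauzy X n.*2), false)].
Proof.
rewrite /window_step; case: insubP => [e _ eu|]; last first.
  by rewrite -[X in ~~ X]/(in_language X u) Lu.
by congr [:: (_, _)]; apply: val_inj.
Qed.

Definition window_label n (G : groupType) (mu : edge (rauzy X n.*2) -> G)
    (u : n.*2.+1.-tuple A) : G :=
  if insub u is Some e then mu e else 1.

Definition steps_of n z N := wprod cat (window_step (n := n)) z N.

Lemma walk_value_steps n (G : groupType) (mu : edge (rauzy X n.*2) -> G) z N :
  walk_value mu (steps_of n z N) = wprod *%g (window_label mu) z N.
Proof.
elim: N z => [//|N IH] z; rewrite /steps_of /= walk_value_cat -/(steps_of n _ N) IH.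
congr (_ * _); rewrite /window_step /window_label; case: insub => //= e.
by rewrite mulg1.
Qed.

Lemma steps_of_walk n z (N : nat) (u v : vertex (rauzy X n.*2)) :
  val u = block z (- n%:Z)%R n.*2 -> val v = block (shl N z) (- n%:Z)%R n.*2 ->
  admissible X n z N -> is_walk u (steps_of n z N) v.
Proof.
elim: N z u => [|N IH] z u uz vz.
  by move=> _; apply/eqP/val_inj; rewrite uz vz shl0.
rewrite /admissible /= => /andP[Lz adm].
rewrite /steps_of /= (window_stepE Lz) /= -/(steps_of n _ N).
set e := to_set_type _; apply/andP; split.
  apply/eqP/val_inj; rewrite uz /= subword_block; apply: eq_block; lia.
apply: IH => //; first by rewrite /= subword_block block_shl.
by rewrite vz shl_shl; have -> : (Posz N + 1)%R = Posz N.+1 by lia.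
Qed.

Lemma steps_of_proj n m (nm : (n <= m)%N) z N : admissible X m z N ->
  map (smap (rauzy_proj X nm)) (steps_of m z N) = steps_of n z N.
Proof.
elim: N z => [//|N IH] z; rewrite /admissible /= => /andP[Lz adm].
have Lz' : in_language X (block z (- n%:Z)%R n.*2.+1).
  apply/mem_set; have /set_mem := Lz; apply: language_sub; lia.
rewrite /steps_of /= (window_stepE Lz) (window_stepE Lz') /= -!/(steps_of _ _ N) IH //.
congr ((_, _) :: _); apply: val_inj; rewrite /= subword_block; apply: eq_block.
by rewrite -subzn //; lia.
Qed.

End RauzyWalks.

Section PathClasses.
Variables (A : finType) (X : set (full_shift A)).
Hypothesis minX : minimal_subshift X.
Variables (x : full_shift A) (Xx : X x).
Implicit Types (k l : free_profinite_semigroup A).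

Let subX : subshift X. Proof. by case: minX. Qed.
Let b n : vertex (rauzy X n.*2) := base Xx n.

Definition loop_steps n (w : seq A) : seq (sedge (rauzy X n.*2)) :=
  splice_prod cat (window_step X (n := n)) x w x.

Lemma loop_steps_walk n w : good X n x x w -> is_walk (b n) (loop_steps n w) (b n).
Proof.
move=> [g1 g2 g3]; apply: steps_of_walk g3; apply/center_block/agree_sym.
  move=> i ni; have [i0|i0] : (i < 0)%R \/ (0 <= i)%R by lia.
    by case: i ni i0 => // i; lia.
  by apply: g1; lia.
move=> i ni; have [i0|i0] : (i < 0)%R \/ (0 <= i)%R by lia.
  by apply: g2; lia.
case: i ni i0 => [i|//] _ _; rewrite /shl -PoszD /splice ltnNge leq_addl /=.
by rewrite addnK.
Qed.

Lemma rauzy_connected n (u : vertex (rauzy X n.*2)) : exists s, is_walk (b n) s u.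
Proof.
have /set_mem Lu := valP u.
have [N rec] := uniform_recurrence minX Lu.
have [i _ e] := rec _ (subshift_shl subX (- n%:Z)%R Xx).
exists (steps_of X n x i); apply: steps_of_walk => //; last exact: admissible_shift.
by rewrite -e !block_shl; apply: eq_block; lia.
Qed.

Lemma loop_steps_value n (G : groupType) (mu : edge (rauzy X n.*2) -> G) w :
  walk_value mu (loop_steps n w) = splice_prod *%g (window_label mu) x w x.
Proof. exact: walk_value_steps. Qed.

Lemma rauzy_label n (t : finite_gcongruence (fundamental_groupoid (rauzy X n.*2))) :
  exists (G : groupType) (mu : edge (rauzy X n.*2) -> G),
  finite_set [set: G] /\
  forall u v (p q : walk u v),
    walk_value mu (steps p) = walk_value mu (steps q) ->
    gpi t (fpi p : @Defs.hom (fundamental_groupoid (rauzy X n.*2)) u v) = gpi t (fpi q).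
Proof.
have tree u := cid (rauzy_connected (n := n) u).
exact: (congruence_label t (p0 := b n) (fun u => Walk (projT2 (tree u)))).
Qed.

Section Limit.
Variables (n : nat) (t : finite_gcongruence (fundamental_groupoid (rauzy X n.*2))).

Let class_spec k (v : @Defs.hom (gquot t) (b n) (b n)) :=
  eventually_approx k
    (fun w : word A => good X n x x w /\ loop_class v (loop_steps n w)).

(** For group labels as in [rauzy_label], the class of the loop of [w] only depends
    on the value of [w], hence on a finite quotient. *)
Lemma limit_class k : joins X x x k -> exists v, class_spec k v.
Proof.
move=> jk; have [G [mu [finG muP]]] := rauzy_label t.
have [t0 t0P] := window_congruence (x 0%R) *%g finG (window_label mu).
have [w gw kw] := ev_exists t0 (jk n).
exists (gpi t (fpi (Walk (loop_steps_walk gw)))).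
apply: evS (evI (jk n) (ev_approx t0 k)) => w' [gw' kw']; split => //.
exists (loop_steps_walk gw'); apply: muP; rewrite /= !loop_steps_value.
by have [_ _ ->] := t0P _ _ ((approx_cong _ kw).1 kw').
Qed.

Definition path_class k (jk : joins X x x k) : @Defs.hom (gquot t) (b n) (b n) :=
  projT1 (cid (limit_class jk)).

Lemma path_classP k (jk : joins X x x k) : class_spec k (path_class jk).
Proof. by rewrite /path_class; case: cid. Qed.

Lemma path_class_congr k l (jk : joins X x x k) (jl : joins X x x l) :
  k = l -> path_class jk = path_class jl.
Proof. by move=> kl; subst l; rewrite (Prop_irrelevance jk jl). Qed.

Lemma path_class_continuous : exists t0 : finite_congruence (word A),
  forall k l (jk : joins X x x k) (jl : joins X x x l),
    at_ t0 k = at_ t0 l -> path_class jk = path_class jl.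
Proof.
have [G [mu [finG muP]]] := rauzy_label t.
have [t0 t0P] := window_congruence (x 0%R) *%g finG (window_label mu).
exists t0 => k l jk jl kl.
have [w [gw [sw ->]] kw] := ev_exists t0 (path_classP jk).
have [w' [gw' [sw' ->]] lw'] := ev_exists t0 (path_classP jl).
apply: muP; rewrite /= !loop_steps_value.
have kw' : approx t0 k w' by rewrite /approx kl.
by have [_ _ ->] := t0P _ _ ((approx_cong _ kw).1 kw').
Qed.

Lemma path_classM k l (jk : joins X x x k) (jl : joins X x x l)
    (jkl : joins X x x (k * l)) :
  path_class jkl = gcomp (path_class jk) (path_class jl).
Proof.
have [t0 klP] := path_classP jkl.
have [w [gw cw] kw] := ev_exists t0 (path_classP jk).
have [w' [gw' cw'] lw'] := ev_exists t0 (path_classP jl).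
have [_ ckl] := klP _ (approxM kw lw').
apply: (loop_class_unique ckl); rewrite /loop_steps /= (splice_prod_good _ _ gw gw').
exact: loop_classM.
Qed.

End Limit.

Lemma path_class_coherent n k (jk : joins X x x k) :
  (fun t : finite_gcongruence (fundamental_groupoid (rauzy X n.*2)) =>
     path_class (n := n) t jk :
     discrete_topology (@Defs.hom (gquot t) (b n) (b n)))
  \in @gcoherent (fundamental_groupoid (rauzy X n.*2)) (b n) (b n).
Proof.
apply/mem_set => t t' le.
have [w [[_ c] [_ c']]] := ev_ex (evI (path_classP t jk) (path_classP t' jk)).
exact: loop_class_coarser c c'.
Qed.

Definition pro_path n k (jk : joins X x x k) : hatPi Xx n :=
  to_set_type (path_class_coherent n jk).

Lemma pro_path_compatible k (jk : joins X x x k) :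
  (fun n => pro_path n.+1 jk) \in @compatible A X x Xx.
Proof.
apply/mem_set => n m nm; apply: pro_homP => t.
pose f := fundamental_functor (rauzy_proj X nm).
have [w [[gm cm] [gn cn]]] :=
  ev_ex (evI (path_classP (pullback f t) jk) (path_classP t jk)).
apply: (loop_class_unique _ cn).
have <- : map (smap (rauzy_proj X nm)) (loop_steps m.+1 w) = loop_steps n.+1 w.
  by apply: steps_of_proj; case: gm.
exact: (@loop_class_map _ _ _ _ _ (rauzy_proj_base Xx nm) (pro_path m.+1 jk) t).
Qed.

Definition lim_path k (jk : joins X x x k) : lim_hatPi Xx :=
  to_set_type (pro_path_compatible jk).

Lemma lim_path_eq (c d : lim_hatPi Xx) :
  (forall n t, val (val c n) t = val (val d n) t) -> c = d.
Proof. by move=> e; apply: lim_hatPiP => n; apply: pro_homP => t; exact: e. Qed.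

Lemma lim_pathM k l (jk : joins X x x k) (jl : joins X x x l)
    (jkl : joins X x x (k * l)) :
  lim_path jkl = lim_path jk * lim_path jl.
Proof. by apply: lim_path_eq => n t; apply: path_classM. Qed.

End PathClasses.

(** * The loop classes separate the profinite words *)

Lemma perm_extend (T : finType) (f : T -> T) (s : seq T) :
  {in s &, injective f} -> exists p : {perm T}, {in s, p =1 f}.
Proof.
elim: s => [|x s IH] inj; first by exists 1.
have [p pf] : exists p : {perm T}, {in s, p =1 f}.
  by apply: IH => y z ys zs; apply: inj; rewrite in_cons ?ys ?zs orbT.
have [xs|xs] := boolP (x \in s).
  by exists p => y; rewrite in_cons => /orP[/eqP ->|]; apply: pf.
exists (p * tperm (p x) (f x)) => y; rewrite permM in_cons => /orP[/eqP ->|ys].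
  by rewrite tpermL.
have xy : x != y by apply: contraNneq xs => ->.
have pxy : p x != p y by rewrite (inj_eq perm_inj).
have fxy : f x != p y.
  rewrite pf //; apply: contraNneq xy => /inj ->; rewrite ?mem_head //.
  by rewrite in_cons ys orbT.
by rewrite tpermD // pf.
Qed.

Section EdgePerm.
Variables (A : finType) (T : finType) (ev : seq A -> T).
Hypothesis evM : forall u u' v v',
  ev u = ev u' -> ev v = ev v' -> ev (u ++ v) = ev (u' ++ v').
Variable X : set (full_shift A).
Hypothesis minX : minimal_subshift X.
Implicit Types (x y z : full_shift A) (u v w : seq A).

Let subX : subshift X. Proof. by case: minX. Qed.

(** Translation by the middle letter of a window is injective on an R-class, and
    so can be completed to a permutation of the finite quotient. *)
Lemma window_perm : exists N, forall n, (N <= n)%N ->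
  exists p : n.*2.+1.-tuple A -> {perm T}, forall z u,
  in_language X (block z (- n%:Z)%R n.*2.+1) -> Rrel ev u (block (shl 1 z) 0 n) ->
  p (block z (- n%:Z)%R n.*2.+1) (ev u) = ev ((z 0%R : A) :: u).
Proof.
have [N act] := letter_action evM minX; exists N => n Nn.
suff /choice[p pP] : forall w : n.*2.+1.-tuple A, exists p : {perm T}, forall z u,
    w = block z (- n%:Z)%R n.*2.+1 ->
    in_language X w -> Rrel ev u (block (shl 1 z) 0 n) ->
    p (ev u) = ev ((z 0%R : A) :: u).
  by exists p => z u Lz uz; apply: pP.
move=> w; case: (boolP (in_language X w)) => [/set_mem Lw|_]; last by exists 1.
have [z Xz wz] := language_recenter subX (- n%:Z)%R Lw.
have Lz : language_of_length X n.*2.+1 (block z (- n%:Z)%R n.*2.+1) by rewrite -wz.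
have [_ [b bP]] := act n z (z 0%R) Nn erefl Lz.
pose cls := [seq s <- enum T |
  `[< exists2 u, Rrel ev u (block (shl 1 z) 0 n) & ev u = s >]].
have clsP s : s \in cls -> exists2 u, Rrel ev u (block (shl 1 z) 0 n) & ev u = s.
  by rewrite mem_filter => /andP[/asboolP].
have [word_of wordP] : exists g : T -> seq A, forall s, s \in cls ->
    Rrel ev (g s) (block (shl 1 z) 0 n) /\ ev (g s) = s.
  suff /choice[g gP] : forall s, exists u, s \in cls ->
      Rrel ev u (block (shl 1 z) 0 n) /\ ev u = s by exists g.
  move=> s; case: (boolP (s \in cls)) => [/clsP[u]|_]; first by exists u.
  by exists [::].
pose f s := ev ((z 0%R : A) :: word_of s).
have [p pf] : exists p : {perm T}, {in cls, p =1 f}.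
  apply: perm_extend => s s' /wordP[us es] /wordP[us' es'] ff.
  rewrite -es -es' -(bP _ us) -(bP _ us'); exact: evM.
exists p => z' u wz' _ uz'.
have /block_agree zz' : block z' (- n%:Z)%R n.*2.+1 = block z (- n%:Z)%R n.*2.+1.
  by rewrite -wz -wz'.
have uz : Rrel ev u (block (shl 1 z) 0 n).
  have <- // : block (shl 1 z') 0 n = block (shl 1 z) 0 n.
  by rewrite !block_shl; apply/block_agree; apply (agree_sub zz'); lia.
have uc : ev u \in cls by rewrite mem_filter mem_enum andbT; apply/asboolP; exists u.
rewrite (pf _ uc) /f; have [_ eu] := wordP _ uc.
have -> : z' 0%R = z 0%R by apply: zz'; lia.
exact: (evM (u := [:: z 0%R]) (u' := [:: z 0%R])).
Qed.

(** Permutations act on the right, whence the inverses: the inverse of the value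
    of a path is left translation by the word that it reads. *)
Lemma perm_value : exists N, forall n, (N <= n)%N ->
  exists mu : n.*2.+1.-tuple A -> {perm T}, forall z M u, admissible X n z M ->
  Rrel ev u (block (shl M z) 0 n) ->
  (wprod *%g mu z M)^-1 (ev u) = ev (block z 0 M ++ u).
Proof.
have [N1 pP] := window_perm; have [N2 act] := admissible_action evM minX.
exists (N1 + N2)%N => n Nn.
have [|p {}pP] := pP n; first lia.
exists (fun c => (p c)^-1) => z M u.
elim: M z => [|M IH] z.
  move=> _ _; rewrite invg1 perm1; congr ev.
  by rewrite (_ : block z 0 0 = [::] :> seq A) //; apply: size0nil; rewrite size_tuple.
rewrite /admissible => /= /andP[Lz adm] uz.
have {}uz : Rrel ev u (block (shl M (shl 1 z)) 0 n).
  by rewrite shl_shl; have -> : (Posz M + 1)%R = Posz M.+1 by lia.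
rewrite invMg invgK permM (IH _ adm uz) pP //; last by apply: act => //; lia.
congr ev; rewrite -[RHS]/(_ ++ _) -add1n block_cat -catA -cat1s; congr cat.
  apply: (@eq_from_nth _ (z 0%R)); rewrite ?size_tuple // => -[|//] _.
  by rewrite nth_block.
by congr cat; congr val; rewrite block_shl.
Qed.

End EdgePerm.

Section Separation.
Variables (A : finType) (X : set (full_shift A)).
Hypothesis minX : minimal_subshift X.
Variables (x : full_shift A) (Xx : X x).

(** The value of a loop for the permutations of [perm_value] determines the
    translation by its label of the value of [e], and [k = k e]. *)
Lemma path_class_separates (t0 : finite_congruence (word A)) :
  exists n (t : finite_gcongruence (fundamental_groupoid (rauzy X n.+1.*2))),
  forall e k l (jk : joins X x x k) (jl : joins X x x l),
    joins X x x e -> e * e = e -> k * e = k -> l * e = l ->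
    path_class minX Xx t jk = path_class minX Xx t jl -> at_ t0 k = at_ t0 l.
Proof.
have [T [ev [evM evP]]] := congruence_evaluation t0.
have [N1 muP] := perm_value evM minX.
have [N2 idem] := idempotent_Rrel evM minX.
pose n := (N1 + N2)%N; have [|mu {}muP] := muP n.+1; first by rewrite /n; lia.
pose lab (e : edge (rauzy X n.+1.*2)) := mu (val e).
have [t tP] := label_congruence lab (finite_finset (T := {perm T})).
exists n, t => e k l jk jl je ee ke le kl.
have [w [gw [sw cw]] kw] := ev_exists t0 (path_classP minX Xx t jk).
have [v [gv [sv cv]] lv] := ev_exists t0 (path_classP minX Xx t jl).
have [q gq eq] := ev_exists t0 (je n.+1).
have qq : ev (q ++ q) = ev q.
  apply/(evP (q * q) q); have := (approx_cong q (approxM eq eq)).1.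
  by rewrite ee; apply.
have qx : Rrel ev q (block x 0 n.+1).
  by apply: idem => //; [rewrite /n; lia|exact: word_neq].
have := kl; rewrite cw cv => /tP /=; rewrite !loop_steps_value.
have value (s : seq A) : good X n.+1 x x s ->
    (splice_prod *%g (window_label lab) x s x)^-1 (ev q) = ev (s ++ q).
  move=> [_ _ g3]; rewrite {2}(splice_letters x s x) -muP //; last first.
    by rewrite block_shl_splice.
  suff -> : splice_prod *%g (window_label lab) x s x =
    wprod *%g mu (splice x s x) (size s) by [].
  rewrite /splice_prod; elim: (size s) (splice x s x) g3 => // M IH z.
  rewrite /admissible /= => /andP[Lz adm]; rewrite IH //; congr (_ * _).
  rewrite /window_label; case: insubP => [d _ <- //|].
  by rewrite -[X in ~~ X]/(in_language X _) Lz.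
move=> /(congr1 (fun p : {perm T} => p^-1 (ev q))); rewrite !value // => wv.
rewrite -ke -le; apply: (approx_eq (approxM kw eq)).
rewrite /approx at_mul (lv : _ = _) (eq : _ = _) [LHS]quot_mulE; apply/quot_piE.
by apply/evP.
Qed.

End Separation.

(** * Density of the loop classes *)

Section Density.
Variables (A : finType) (X : set (full_shift A)).
Hypothesis minX : minimal_subshift X.
Variables (x : full_shift A) (Xx : X x).
Implicit Types (y z : full_shift A) (k l r : free_profinite_semigroup A).

Let subX : subshift X. Proof. by case: minX. Qed.

(* The axioms of a group of profinite words that join [x] to itself, with [EC] the
   form that maximality takes. *)
Variables (E : set (free_profinite_semigroup A)) (e : free_profinite_semigroup A).
Hypothesis EJ : forall k, E k -> joins X x x k.
Hypothesis EM : forall k l, E k -> E l -> E (k * l).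
Hypothesis Ee : E e.
Hypothesis ee : e * e = e.
Hypothesis EV : forall k, E k -> exists2 l, E l & k * l = e.
Hypothesis EC : forall r, joins X x x r -> E (e * r * e).

Section Level.
Variables (n : nat) (G : groupType) (mu : edge (rauzy X n.*2) -> G).
Hypothesis finG : finite_set [set: G].

Let prod (w : seq A) : G := splice_prod *%g (window_label mu) x w x.

Let has_value k g := eventually_approx k (fun w : word A => good X n x x w /\ prod w = g).

Let value_exists k : joins X x x k -> exists g, has_value k g.
Proof.
move=> jk; have [t tP] := window_congruence (x 0%R) *%g finG (window_label mu).
have [w gw kw] := ev_exists t (jk n); exists (prod w).
apply: evS (evI (jk n) (ev_approx t k)) => v [gv kv]; split => //.
by have [_ _ h] := tP _ _ ((approx_cong _ kv).1 kw); apply: h.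
Qed.

Let value_unique k g h : has_value k g -> has_value k h -> g = h.
Proof. by move=> kg /(evI kg) /ev_ex[w [[_ <-] [_ <-]]]. Qed.

Let valueM k l g h : has_value k g -> has_value l h -> has_value (k * l) (g * h).
Proof.
move=> kg lh; apply: evI.
  apply: (recognizable_evM _ kg lh); first exact: recognizable_good.
  by move=> w v [gw _] [gv _]; exact: (good_cat gw gv).
apply: (recognizable_evM _ kg lh); first exact: recognizable_prod.
by move=> w v [gw <-] [gv <-]; exact: (splice_prod_good _ _ gw gv).
Qed.

Let B g := exists2 k, E k & has_value k g.

Let value_e : has_value e 1.
Proof.
have [g eg] := value_exists (EJ Ee); suff <- : g = 1 by [].
have := valueM eg eg; rewrite ee => /(value_unique eg) gg.
by apply: (mulgI g); rewrite -gg mulg1.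
Qed.

Let B1 : B 1. Proof. by exists e. Qed.

Let BM g h : B g -> B h -> B (g * h).
Proof.
by move=> [k Ek kg] [l El lh]; exists (k * l); [apply: EM|apply: valueM].
Qed.

Let BV g : B g -> B g^-1.
Proof.
move=> [k Ek kg]; have [l El kl] := EV Ek.
have [h lh] := value_exists (EJ El); exists l => //.
suff -> : g^-1 = h by [].
have := valueM kg lh; rewrite kl => /(value_unique value_e) gh.
by apply: (mulgI g); rewrite mulgV.
Qed.

(** Otherwise a cluster point of a sequence of bad return words to longer and
    longer central blocks of [x] would give an element of [E] with the value of
    one of them. *)
Let return_values : exists2 m, (n <= m)%N & forall z (N : nat), X z ->
  agree (- m%:Z)%R m z x -> agree (- m%:Z)%R m (shl N z) x ->
  B (wprod *%g (window_label mu) z N).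
Proof.
apply: contrapT => nB.
have bad j : {w : word A | good X (n + j) x x w /\ ~ B (prod w)}.
  apply: cid; apply: contrapT => nw; apply: nB; exists (n + j)%N; first exact: leq_addr.
  move=> z [|N] Xz z0 zN; first exact: B1.
  apply: contrapT => nBz; apply: nw.
  have ne : (block z 0 N.+1 : seq A) != [::] by rewrite -size_eq0 size_tuple.
  exists (Word ne); split; first exact: good_block.
  rewrite /prod /= splice_prod_block //.
    by apply (agree_sub z0); lia.
  by apply (agree_sub zN); lia.
have [r jr rP] := joins_cluster (fun j => good_le (leq_addl n j) (projT2 (bad j)).1).
have [g rg] := value_exists jr; have [j _ /ev_eta[_ pg]] := rP _ rg 0.
have [_] := projT2 (bad j); apply; rewrite pg; exists (e * r * e); first exact: EC.
by have := valueM (valueM value_e rg) value_e; rewrite mul1g mulg1.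
Qed.

(** In a vertex of large order [2 m], choose an occurrence of the central block of
    [x] given by [return_values]. The value of the path from this occurrence to the
    centre of the vertex is a potential: along an edge, the defect of the
    potential is the value of a path between two occurrences of the block, or the
    inverse of one. *)
Lemma loop_values : exists M, forall m (nm : (n <= m)%N), (M <= m)%N ->
  forall s, is_walk (base Xx m) s (base Xx m) ->
  exists2 k, E k & has_value k (walk_value mu (map (smap (rauzy_proj X nm)) s)).
Proof.
have [k0 nk0 ret] := return_values.
have Lx : language_of_length X k0.*2 (block x (- k0%:Z)%R k0.*2).
  by exists x, (- k0%:Z)%R.
have [N rec] := uniform_recurrence minX Lx.
exists (N + k0)%N => m nm Nm.
have occ (u : vertex (rauzy X m.*2)) : exists zd : full_shift A * nat,
    [/\ X zd.1, val u = block zd.1 (- m%:Z)%R m.*2, (zd.2 <= N)%N &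
        agree (- k0%:Z)%R k0 (shl (- zd.2%:Z)%R zd.1) x].
  have /set_mem Lu := valP u.
  have [z Xz uz] := language_recenter subX (- m%:Z)%R Lu.
  have [i iN e'] := rec _ (subshift_shl subX (- (N + k0)%N%:Z)%R Xz).
  exists (z, (N - i)%N); split => //=; first lia.
  apply/center_block; rewrite -e' !block_shl; apply: eq_block; lia.
pose zd u := projT1 (cid (occ u)).
have zdP u : [/\ X (zd u).1, val u = block (zd u).1 (- m%:Z)%R m.*2, ((zd u).2 <= N)%N &
    agree (- k0%:Z)%R k0 (shl (- (zd u).2%:Z)%R (zd u).1) x].
  by rewrite /zd; case: cid.
pose P z d := wprod *%g (window_label mu) (shl (- d%:Z)%R z) d.
pose pot u := P (zd u).1 (zd u).2.
have potE u z : val u = block z (- m%:Z)%R m.*2 ->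
    pot u = P z (zd u).2 /\ agree (- k0%:Z)%R k0 (shl (- (zd u).2%:Z)%R z) x.
  move=> uz; have [_ uz' dN ax] := zdP u.
  have /center_block zz : block z (- m%:Z)%R m.*2 = block (zd u).1 (- m%:Z)%R m.*2.
    by rewrite -uz -uz'.
  split.
    apply: wprod_agree; apply: agree_sym; apply (agree_shl (N := (- (zd u).2%:Z)%R)).
    by apply (agree_sub zz); lia.
  apply (agree_trans (z2 := shl (- (zd u).2%:Z)%R (zd u).1)); last exact: ax.
  by apply (agree_shl (N := (- (zd u).2%:Z)%R)); apply (agree_sub zz); lia.
pose f := smap (rauzy_proj X nm).
have edgeB (c : edge (rauzy X m.*2)) : exists2 g, B g &
    pot (source c) * mu (emap (rauzy_proj X nm) c) = g * pot (target c).
  have /set_mem Lc := valP c.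
  have [z Xz cz] := language_recenter subX (- m%:Z)%R Lc.
  have [->] : pot (source c) = P z (zd (source c)).2 /\
      agree (- k0%:Z)%R k0 (shl (- (zd (source c)).2%:Z)%R z) x.
    by apply: potE; rewrite /= cz subword_block; apply: eq_block; lia.
  have [->] : pot (target c) = P (shl 1 z) (zd (target c)).2 /\
      agree (- k0%:Z)%R k0 (shl (- (zd (target c)).2%:Z)%R (shl 1 z)) x.
    by apply: potE; rewrite /= cz subword_block block_shl; apply: eq_block; lia.
  rewrite shl_shl => a' a.
  have [_ _ dN _] := zdP (source c); have [_ _ dN' _] := zdP (target c).
  move: (zd (source c)).2 (zd (target c)).2 dN dN' a a' => d d' dN dN' a a'.
  have -> : mu (emap (rauzy_proj X nm) c) =
      wprod *%g (window_label mu) (shl d (shl (- d%:Z)%R z)) 1.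
    rewrite shl_shl GRing.addrN shl0 /= mulg1 /window_label.
    have ce : val (emap (rauzy_proj X nm) c) = block z (- n%:Z)%R n.*2.+1.
      by rewrite /= cz subword_block; apply: eq_block; rewrite -subzn //; lia.
    case: insubP => [c' _|]; first by rewrite -ce => /val_inj ->.
    by rewrite -ce; have -> := valP (emap (rauzy_proj X nm) c).
  rewrite /P -wprod_add shl_shl.
  (* The two occurrences come in either order in the window. *)
  have [dd|dd] := leqP d' (d + 1).
    exists (wprod *%g (window_label mu) (shl (- d%:Z)%R z) (d + 1 - d')).
      apply: ret => //; first exact: subshift_shl.
      by rewrite shl_shl; have -> : ((d + 1 - d')%N%:Z + - d%:Z = - d'%:Z + 1)%R by lia.
    have {1}-> : (d + 1 = (d + 1 - d') + d')%N by lia.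
    rewrite wprod_add shl_shl.
    by have -> : ((d + 1 - d')%N%:Z + - d%:Z = - d'%:Z + 1)%R by lia.
  exists (wprod *%g (window_label mu) (shl (- d'%:Z + 1)%R z) (d' - (d + 1)))^-1.
    apply/BV/ret => //; first exact: subshift_shl.
    by rewrite shl_shl; have -> : ((d' - (d + 1))%N%:Z + (- d'%:Z + 1) = - d%:Z)%R by lia.
  rewrite -[X in _ * wprod _ _ _ X](subnK (ltnW dd)).
  rewrite [X in _ * X]wprod_add shl_shl.
  have -> : ((d' - (d + 1))%N%:Z + (- d'%:Z + 1) = - d%:Z)%R by lia.
  by rewrite mulKg.
have walkB s u v : is_walk u s v ->
    exists2 g, B g & pot u * walk_value mu (map f s) = g * pot v.
  elim: s u => [|[c b] s IH] u /=.
    by move=> /eqP ->; exists 1; [exact: B1|rewrite mul1g mulg1].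
  move=> /andP[/eqP -> /IH[g Bg gs]]; have [h Bh hc] := edgeB c.
  case: b {IH} gs => /= gs.
    exists (h^-1 * g); first by apply: BM => //; apply: BV.
    rewrite -mulgA -gs !mulgA; congr (_ * _).
    by apply: (mulIg (mu (emap (rauzy_proj X nm) c))); rewrite mulgKV -mulgA hc mulKg.
  exists (h * g); first exact: BM.
  by rewrite mulgA hc -!mulgA gs.
move=> s /walkB[g Bg gs].
have Bpot : B (pot (base Xx m)).
  have [-> a] : pot (base Xx m) = P x (zd (base Xx m)).2 /\
      agree (- k0%:Z)%R k0 (shl (- (zd (base Xx m)).2%:Z)%R x) x by apply: potE.
  apply: ret => //; first exact: subshift_shl.
  by rewrite shl_shl GRing.addrN shl0.
have -> : walk_value mu (map f s) = (pot (base Xx m))^-1 * (g * pot (base Xx m)).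
  by rewrite -gs mulKg.
by apply: BM; [apply: BV|apply: BM].
Qed.

End Level.

Lemma path_class_dense (c : lim_hatPi Xx) n
    (t : finite_gcongruence (fundamental_groupoid (rauzy X n.+1.*2))) :
  exists k (jk : joins X x x k), E k /\ path_class minX Xx t jk = val (val c n) t.
Proof.
have [G [mu [finG muP]]] := rauzy_label minX Xx t.
have [M loopP] := loop_values mu finG.
pose m := (M + n)%N; have nm : (n.+1 <= m.+1)%N by rewrite /m; lia.
have Mm : (M <= m.+1)%N by rewrite /m; lia.
pose f := fundamental_functor (rauzy_proj X nm).
have [s sc] := loop_class_repr (val (val c m) (pullback f t)).
have [sw _] := sc; have [k Ek kv] := loopP _ nm Mm s sw.
have jk := EJ Ek; exists k, jk; split => //.
have [w [[_ wv] [_ [ww ->]]]] := ev_ex (evI kv (path_classP minX Xx t jk)).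
have := @loop_class_map _ _ _ _ _ (rauzy_proj_base Xx nm) (val c m) t s sc.
have -> : pro_local_map (F := f) (rauzy_proj_base Xx nm) (val c m) = val c n.
  by have /set_mem := valP c; apply.
move=> [sw' ->]; apply: muP => /=; rewrite loop_steps_value; exact: wv.
Qed.

End Density.

(** * The topology of the inverse limit *)

Lemma gcongruence_meet (G : groupoid) (t1 t2 : finite_gcongruence G) :
  exists t : finite_gcongruence G,
    (forall u v f g, t u v f g -> t1 u v f g) /\
    (forall u v f g, t u v f g -> t2 u v f g).
Proof.
pose r u v : rel (@Defs.hom G u v) := fun f g => t1 u v f g && t2 u v f g.
have rr u v : reflexive (r u v) by move=> f; rewrite /r !equiv_refl.
have rs u v : symmetric (r u v).
  by move=> f g; rewrite /r equiv_sym [t2 _ _ _ _]equiv_sym.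
have rt u v : transitive (r u v).
  move=> g f h /andP[a1 a2] /andP[b1 b2].
  by rewrite /r (equiv_trans a1 b1) (equiv_trans a2 b2).
pose q u v : equiv_rel (@Defs.hom G u v) :=
  EquivRel (r u v) (@rr u v) (@rs u v) (@rt u v).
have qM u v w (f f' : @Defs.hom G u v) (g g' : @Defs.hom G v w) :
    q u v f f' -> q v w g g' -> q u w (gcomp f g) (gcomp f' g').
  by move=> /andP[a1 a2] /andP[b1 b2]; apply/andP; split; apply: gcongM.
have qfin u v : finite_set [set: {eq_quot (q u v)}].
  have [N1 [c1 i1]] := finite_code (gcong_finite t1 u v).
  have [N2 [c2 i2]] := finite_code (gcong_finite t2 u v).
  pose c (a : {eq_quot (q u v)}) := (c1 (gpi t1 (repr a)), c2 (gpi t2 (repr a))).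
  apply: (@finite_setT_inj _ _ c) => a b [/i1 /gpiE ab1 /i2 /gpiE ab2].
  by rewrite -[a]reprK -[b]reprK; apply/eqquotP/andP.
by exists (FiniteGCongruence qM qfin); split=> u v f g /andP[].
Qed.

Section LimitTopology.
Variables (A : finType) (X : set (full_shift A)) (x : full_shift A) (Xx : X x).
Implicit Types c d : lim_hatPi Xx.

Lemma near_lim c n t : \forall d \near c, val (val d n) t = val (val c n) t.
Proof.
pose U : set (lim_hatPi Xx) := [set d | val (val d n) t = val (val c n) t].
pose V : set (hatPi Xx n.+1) := [set d | val d t = val (val c n) t].
have nV : nbhs (val c n) V.
  exact: (@initial_continuous _ _ set_val (val c n) [set d | d t = val (val c n) t]
    (near_coordinate _ t)).
exact: (@initial_continuous _ _ set_val c [set d | V (d n)]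
    (@near_product _ (fun n => hatPi Xx n.+1 : topologicalType) (val c) n V nV)).
Qed.

Lemma cvg_lim_hatPi c (F : set_system (lim_hatPi Xx)) : Filter F ->
  (forall n t, F [set d | val (val d n) t = val (val c n) t]) -> F --> c.
Proof.
move=> FF Fnt; apply: cvg_initial.
apply: (@cvg_product _ (fun n => hatPi Xx n.+1 : topologicalType)) => n.
by apply: cvg_initial; apply: cvg_coordinates => t; apply: Fnt.
Qed.

Lemma lim_coordinate_level n m (nm : (n.+1 <= m.+1)%N) t c d :
  val (val c m) (pullback (fundamental_functor (rauzy_proj X nm)) t) =
  val (val d m) (pullback (fundamental_functor (rauzy_proj X nm)) t) ->
  val (val c n) t = val (val d n) t.
Proof.
have <- : hatPi_map nm (val c m) = val c n by have /set_mem := valP c; apply.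
have <- : hatPi_map nm (val d m) = val d n by have /set_mem := valP d; apply.
move: (val c m) (val d m) => c' d' e; rewrite /hatPi_map.
by case: _ / (rauzy_proj_base Xx nm); rewrite /pro_local_map /= e.
Qed.

Lemma lim_coordinate_coarser n
    (t t' : finite_gcongruence (fundamental_groupoid (rauzy X n.+1.*2))) c d :
  (forall u v f g, t u v f g -> t' u v f g) ->
  val (val c n) t = val (val d n) t -> val (val c n) t' = val (val d n) t'.
Proof.
move=> le e; have /set_mem cc := valP (val c n); have /set_mem dd := valP (val d n).
by rewrite -(cc _ _ le) -(dd _ _ le) e.
Qed.

(** The coordinates of the inverse limit are directed. *)
Lemma lim_coordinate_pair n1 t1 n2 t2 : exists m t, forall c d,
  val (val c m) t = val (val d m) t ->
  val (val c n1) t1 = val (val d n1) t1 /\ val (val c n2) t2 = val (val d n2) t2.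
Proof.
pose m := (n1 + n2)%N.
have l1 : (n1.+1 <= m.+1)%N by rewrite /m; lia.
have l2 : (n2.+1 <= m.+1)%N by rewrite /m; lia.
have [t [le1 le2]] := gcongruence_meet
  (pullback (fundamental_functor (rauzy_proj X l1)) t1)
  (pullback (fundamental_functor (rauzy_proj X l2)) t2).
exists m, t => c d e; split; [apply: (@lim_coordinate_level _ _ l1)|
  apply: (@lim_coordinate_level _ _ l2)]; exact: lim_coordinate_coarser e.
Qed.

End LimitTopology.

(** * The isomorphism *)

(** The setting to which the theorem reduces: a maximal subgroup together with two
    profinite words conjugating it into a group of loops at [x]. *)
Section Isomorphism.
Variables (A : finType) (X : set (full_shift A)).
Hypothesis minX : minimal_subshift X.
Variables (x : full_shift A) (Xx : X x).
Variables (H : set (free_profinite_semigroup A)) (e K K' : free_profinite_semigroup A).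
Implicit Types (h k r : free_profinite_semigroup A) (c d : lim_hatPi Xx).
Hypothesis maxH : maximal_subgroup H.
Hypotheses (He : H e) (ee : e * e = e).
Hypothesis HM : forall h k, H h -> H k -> H (h * k).
Hypothesis eH : forall h, H h -> e * h = h /\ h * e = h.
Hypothesis HV : forall h, H h -> exists2 k, H k & h * k = e.
Hypotheses (KK : K' * K = e) (Ke : K * e = K).
Hypothesis KJ : forall h, H h -> joins X x x (K * h * K').
Hypothesis KC : forall r, joins X x x r -> H (K' * r * K).

Let cj h := K * h * K'.

Let cjM h k : H h -> H k -> cj (h * k) = cj h * cj k.
Proof.
move=> Hh Hk; have [_ he] := eH Hh.
by rewrite /cj -{1}he -KK !mulgA.
Qed.

Let cjK h : H h -> K' * cj h * K = h.
Proof.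
move=> Hh; have [eh he] := eH Hh.
by rewrite /cj !mulgA KK eh -mulgA KK.
Qed.

Let cong n := finite_gcongruence (fundamental_groupoid (rauzy X n.+1.*2)).

Let loop h (Hh : H h) n (t : cong n) := path_class minX Xx t (KJ Hh).

Let fe : cj e * cj e = cj e.
Proof. by rewrite -cjM // ee. Qed.

Let dense c n (t : cong n) : exists h (Hh : H h), loop Hh t = val (val c n) t.
Proof.
pose E := [set cj h | h in H].
have EJ k : E k -> joins X x x k by move=> [h Hh <-]; exact: KJ.
have [||||k [jk [[h Hh hk] kc]]] :=
    @path_class_dense _ _ minX _ Xx E (cj e) EJ _ _ fe _ _ c n t.
- move=> _ _ [h Hh <-] [k Hk <-]; exists (h * k); [exact: HM|exact: cjM].
- by exists e.
- move=> _ [h Hh <-]; have [k Hk hk] := HV Hh; exists (cj k); first by exists k.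
  by rewrite -cjM // hk.
- move=> r jr; exists (K' * r * K); first exact: KC.
  by rewrite /cj Ke !mulgA.
by exists h, Hh; rewrite -kc; apply: path_class_congr.
Qed.

Let separates (t0 : finite_congruence (word A)) : exists n (t : cong n),
  forall h k (Hh : H h) (Hk : H k), loop Hh t = loop Hk t -> at_ t0 h = at_ t0 k.
Proof.
have [n [t sep]] := path_class_separates minX Xx t0; exists n, t => h k Hh Hk p.
have cje l : H l -> cj l * cj e = cj l.
  by move=> Hl; rewrite -cjM //; have [_ ->] := eH Hl.
have := sep _ _ _ _ _ (KJ He) fe (cje _ Hh) (cje _ Hk) p.
by rewrite -{2}(cjK Hh) -{2}(cjK Hk) !at_mul => ->.
Qed.

Let separating_level t0 : {n : nat & {t : cong n | forall h k (Hh : H h) (Hk : H k),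
  loop Hh t = loop Hk t -> at_ t0 h = at_ t0 k}}.
Proof.
by have [n nP] := cid (separates t0); have [t tP] := cid nP; exists n, t.
Qed.

Let level t0 : nat := projT1 (separating_level t0).
Let sepc t0 : cong (level t0) := sval (projT2 (separating_level t0)).
Let sepP t0 h k (Hh : H h) (Hk : H k) :
  loop Hh (sepc t0) = loop Hk (sepc t0) -> at_ t0 h = at_ t0 k.
Proof. exact: svalP (projT2 (separating_level t0)) h k Hh Hk. Qed.

(** The coordinate at [t0] of the preimage of [c] is read on an element of [H] whose
    image has the coordinate of [c] in a finite quotient that determines it. *)
Let pt_sig c t0 :
  {h | exists Hh : H h, loop Hh (sepc t0) = val (val c (level t0)) (sepc t0)}.
Proof. exact: cid (dense c (sepc t0)). Qed.

Let pt c t0 := sval (pt_sig c t0).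

Let ptP c t0 h (Hh : H h) :
  loop Hh (sepc t0) = val (val c (level t0)) (sepc t0) ->
  at_ t0 h = at_ t0 (pt c t0).
Proof.
have [Hk kc] := svalP (pt_sig c t0) => hc.
exact: sepP (etrans hc (esym kc)).
Qed.

(** As the coordinates are directed, one element of [H] can serve both for the
    coordinate at [t0] and for any given coordinate of the image. *)
Let approximants c t0 n (t : cong n) : exists h (Hh : H h),
  at_ t0 h = at_ t0 (pt c t0) /\ loop Hh t = val (val c n) t.
Proof.
have [m [t' pair]] := lim_coordinate_pair Xx (sepc t0) t.
have [h [Hh hc]] := dense c t'; exists h, Hh.
have [p1 p2] := pair (lim_path minX Xx (KJ Hh)) c hc.
by split; [exact: ptP p1|].
Qed.

Let inv_coherent c :
  (fun t0 => at_ t0 (pt c t0) : discrete_topology (quot t0)) \in @coherent (word A).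
Proof.
apply/mem_set => t0 t1 le.
have [h [Hh [h0 h1]]] := approximants c t0 (sepc t1).
by rewrite -h0 -(ptP h1) (at_coarser h le).
Qed.

Let inv c : free_profinite_semigroup A := to_set_type (inv_coherent c).

Let invP c t0 h (Hh : H h) :
  loop Hh (sepc t0) = val (val c (level t0)) (sepc t0) ->
  at_ t0 h = at_ t0 (inv c).
Proof. exact: ptP. Qed.

Let invM c d : inv (c * d) = inv c * inv d.
Proof.
apply: completionP => t0; rewrite at_mul.
have [h [Hh hc]] := dense c (sepc t0).
have [k [Hk kd]] := dense d (sepc t0).
rewrite -(invP hc) -(invP kd) -at_mul; apply/esym/(invP (Hh := HM Hh Hk)).
have jhk : joins X x x (cj h * cj k) by rewrite -cjM //; exact: KJ (HM Hh Hk).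
have -> : loop (HM Hh Hk) (sepc t0) = path_class minX Xx (sepc t0) jhk.
  by apply: path_class_congr; exact: cjM.
rewrite (path_classM _ _ _ (KJ Hh) (KJ Hk)).
exact: congr2 hc kd.
Qed.

Let inv_cj h (Hh : H h) : inv (lim_path minX Xx (KJ Hh)) = h.
Proof. by apply: completionP => t0; apply/esym/(invP (Hh := Hh)). Qed.

Let inv1 : inv 1 = e.
Proof.
rewrite -(inv_cj He); congr inv.
have := lim_pathM minX Xx (KJ He) (KJ He).
have jee : joins X x x (cj e * cj e) by rewrite fe; exact: KJ.
move=> /(_ jee); have -> : lim_path minX Xx jee = lim_path minX Xx (KJ He).
  by apply: lim_path_eq => n t; apply: path_class_congr.
by move=> ff; apply: (mulgI (lim_path minX Xx (KJ He))); rewrite -ff mulg1.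
Qed.

(** The range of [inv] is a subgroup because [inv] is multiplicative, and it contains
    [H], which is maximal. *)
Let range_inv : range inv = H.
Proof.
case: maxH => _ maxl; apply: maxl; last by move=> h Hh; exists (lim_path minX Xx (KJ Hh)).
split=> [_ _ [c _ <-] [d _ <-]|]; first by exists (c * d) => //; apply: invM.
exists e; split; first by exists 1 => //; exact: inv1.
  by move=> _ [c _ <-]; rewrite -inv1 -!invM mul1g mulg1.
move=> _ [c _ <-]; exists (inv c^-1); split; first by exists c^-1.
  by rewrite -invM mulgV inv1.
by rewrite -invM mulVg inv1.
Qed.

Let invH c : H (inv c).
Proof. by rewrite -range_inv; exists c. Qed.

Let fwd h : lim_hatPi Xx :=
  if pselect (H h) is left Hh then lim_path minX Xx (KJ Hh) else 1.

Let fwdE h (Hh : H h) : fwd h = lim_path minX Xx (KJ Hh).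
Proof.
rewrite /fwd; case: pselect => // Hh'; apply: lim_path_eq => n t.
exact: path_class_congr.
Qed.

Let invK : cancel inv fwd.
Proof.
move=> c; rewrite (fwdE (invH c)); apply: lim_path_eq => n t.
have [t0 cont] := path_class_continuous minX Xx t.
have [h [Hh [h0 <-]]] := approximants c t0 t.
by apply: cont; rewrite /cj !at_mul h0.
Qed.

Lemma isomorphism_of_conjugation : isomorphic_topological_group H (lim_hatPi Xx).
Proof.
exists fwd, inv; split.
- by move=> h /set_mem Hh; rewrite (fwdE Hh).
- by split; [exact: invH|exact: invK].
- move=> h k /set_mem Hh /set_mem Hk.
  by rewrite -[h in LHS](inv_cj Hh) -[k in LHS](inv_cj Hk) -invM invK !fwdE.
- apply/subspace_continuousP => h Hh; apply: cvg_lim_hatPi => n t.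
  have [t0 cont] := path_class_continuous minX Xx t.
  apply: filterS (near_at t0 h) => k kh Hk.
  suff : val (val (fwd k) n) t = val (val (fwd h) n) t by [].
  by rewrite (fwdE Hk) (fwdE Hh); apply: cont; rewrite !at_mul kh.
- move=> c; have FF : Filter (inv @ nbhs c) := fmap_filter inv (nbhs_filter c).
  apply: (@cvg_completion _ (inv c) _ FF) => t0.
  apply: filterS (near_lim c (sepc t0)) => d dc.
  have [h [Hh hc]] := dense c (sepc t0).
  by rewrite /= -[LHS](invP (Hh := Hh)) ?hc // -(invP hc).
Qed.

End Isomorphism.

Theorem corollary8p13 (A : finType) (X : set (full_shift A))
    (minX : minimal_subshift X) (x : full_shift A) (Xx : X x)
    (H : set (free_profinite_semigroup A)) (HX : schutzenberger_group X H) :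
  isomorphic_topological_group H (lim_hatPi Xx).
Proof.
have [subX _] := minX; have [maxH [J [_ JL _] HJ]] := HX.
have [[HM [e [He H1 HV]]] _] := maxH.
have ee : e * e = e by have [] := H1 _ He.
have HL : H `<=` language_closure X by move=> h /HJ /JL.
have [y Xy Hy] := subgroup_point subX (x 0%R) He ee H1 HL.
have HC r : joins X y y r -> H (e * r * e).
  move=> jr; apply: (locally_right_invertible maxH He ee).
  - by rewrite !mulgA ee.
  - by rewrite -!mulgA ee.
  - by move=> t; exact: (joins_right_invertible minX t (Hy _ He) ee jr).
have [K0 jK0] := joins_exists minX Xx Xy.
have [K1 jK1] := joins_exists minX Xy Xx.
have [s [Hs _ s1]] := HV _ (HC _ (joinsM jK1 jK0)).
have [es se] := H1 _ Hs.
(* [s] corrects [K1] into an inverse of [K0 e] on the side of [y]. *)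
have KK : (s * K1) * (K0 * e) = e by rewrite -[RHS]s1 !mulgA se.
have jK : joins X x y (K0 * e) := joinsM jK0 (Hy _ He).
have jK' : joins X y x (s * K1) := joinsM (Hy _ Hs) jK1.
apply: (@isomorphism_of_conjugation _ _ minX _ Xx _ e (K0 * e) (s * K1)) => //.
- by move=> h Hh; have [k [Hk hk _]] := HV _ Hh; exists k.
- by rewrite -mulgA ee.
- by move=> h Hh; exact: joinsM (joinsM jK (Hy _ Hh)) jK'.
- move=> r jr; have -> : s * K1 * r * (K0 * e) = e * ((s * K1) * r * K0) * e.
    by rewrite !mulgA es.
  by apply: HC; exact: joinsM (joinsM jK' jr) jK0.
Qed.
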